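(* Let $(R, \mathfrak{m}, \mathbb{F}_q)$ be a complete Noetherian local ring with finite residue field $\mathbb{F}_q$, equipped with its Haar measure, and let $\mathfrak{a} \subseteq \mathfrak{m}$ be an ideal with $R/\mathfrak{a}$ finite. Let $G$ be a finite $R$-module, let $n \geq 1$, $u \in \mathbb{Z}_{\geq 0}$, and let $\bar X \in \mathrm{M}_{n\times(n+u)}(R/\mathfrak{a})$ satisfy $\mathrm{cok}_{R/\mathfrak a}(\bar X) \simeq_R G/\mathfrak{a}G$. Write $b_i := \beta_i^R(G)$ for $i = 0,1$ and $b_1' := \beta_1^{R/\mathfrak a}(G/\mathfrak a G)$. Then \[\underset{X \in \mathrm{M}_{n\times(n+u)}(R)}{\mathrm{Prob}}\big(\mathrm{cok}(X) \simeq_R G \,\big|\, X \equiv \bar X \pmod{\mathfrak a}\big) = \begin{cases} \dfrac{|\mathrm{Aut}_R(G/\mathfrak a G)|}{|\mathrm{Aut}_R(G)|\,|\mathfrak a G|^u} \displaystyle\prod_{i = u + b_0 - b_1 + 1}^{u + b_0 - b_1'}(1 - q^{-i}), & b_0 \geq b_1 - u,\\ 0, & b_0 < b_1 - u.\end{cases}\] In particular, this conditional probability does not depend on $n$.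
   Context: $\beta_i^S(M) := \dim_\kappa \mathrm{Tor}_i^S(M,\kappa)$ for a Noetherian local ring $S$ with residue field $\kappa$ (ranks in a minimal free resolution). $\mathrm{cok}(X)$ is $R^n$ modulo the column span of $X$; similarly over $R/\mathfrak a$. An empty product equals $1$. *)

(* Defs.v *)
From HB Require Import structures.
From mathcomp Require Import all_boot all_order all_algebra generic_quotient ring_quotient finmap.
From mathcomp Require Import all_classical all_reals all_analysis.

Set Implicit Arguments.
Unset Strict Implicit.
Unset Printing Implicit Defensive.

Import Order.TTheory GRing.Theory Num.Theory.

Local Open Scope ring_scope.
Local Open Scope quotient_scope.
Local Open Scope classical_set_scope.

(* 0 on infinite sets *)
Definition ncard (T : choiceType) (A : set T) : nat := #|` fset_set A|%fset.

(* Ideals are the proper ideals [idealr R] of the library; they are boolean *)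
(* predicates, so Prop-valued ones are turned into booleans with `[< _ >].  *)

HB.mixin Record isMaxIdeal (R : comNzRingType) (S : R -> bool) := {
  max_ideal_subproof :
    forall J : idealr R, {subset S <= J} -> {subset J <= S}
}.

#[short(type="maxIdealr")]
HB.structure Definition MaxIdealr (R : comNzRingType) :=
  {S of Idealr R S & isMaxIdeal R S}.

Definition local_ring (R : comNzRingType) (m : maxIdealr R) : Prop :=
  forall J : maxIdealr R, J =i m.

Definition noetherian (R : comNzRingType) : Prop :=
  forall I : idealr R, exists (k : nat) (g : 'I_k -> R),
    forall x, x \in I <-> exists c : 'I_k -> R, x = \sum_(i < k) c i * g i.

Section IdealPower.
Variable R : comNzRingType.
Implicit Types I J : set R.

Definition ideal_mul I J : set R :=
  [set x | exists (l : nat) (y z : 'I_l -> R),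
     [/\ forall j, I (y j), forall j, J (z j) & x = \sum_(j < l) y j * z j]].

Fixpoint ideal_pow I (k : nat) : set R :=
  if k is k'.+1 then ideal_mul I (ideal_pow I k') else setT.

End IdealPower.

(* R -> lim_k R / m^k is bijective; in particular R is m-adically separated. *)
Definition adically_complete (R : comNzRingType) (m : idealr R) : Prop :=
  forall x : nat -> R,
    (forall k, ideal_pow [set` m] k (x k.+1 - x k)) ->
    exists! l, forall k, ideal_pow [set` m] k (x k - l).

(* R with the m-adic topology; matrices over [adic] then carry the product
   topology of the library. *)
Definition adic (R : comNzRingType) (m : idealr R) : Type := R.

Section AdicTopology.
Variables (R : comNzRingType) (m : idealr R).
Local Notation mpow := (ideal_pow [set` m]).

Lemma ideal_pow0 k : mpow k 0.
Proof.
case: k => [//|k]; exists 0%N, (fun=> 0), (fun=> 0); split.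
- by case.
- by case.
- by rewrite big_ord0.
Qed.

Lemma ideal_powMl k a x : mpow k x -> mpow k (a * x).
Proof.
case: k => [//|k] [l [y [z [yI zJ ->]]]].
exists l, (fun j => a * y j), z; split=> // [j|].
  by apply: idealMr; exact: yI.
by rewrite mulr_sumr; apply: eq_bigr => j _; rewrite mulrA.
Qed.

Lemma ideal_powS k : mpow k.+1 `<=` mpow k.
Proof.
suff H : forall l (y z : 'I_l -> R), (forall j, mpow k (z j)) ->
    mpow k (\sum_(j < l) y j * z j).
  by move=> x [l [y [z [_ zJ ->]]]]; exact: H.
move=> l y z zJ; elim/big_ind: _ => [||j _]; first exact: ideal_pow0.
- case: k zJ => [//|k] _ x1 x2 [l1 [y1 [z1 [y1I z1J ->]]]].
  move=> [l2 [y2 [z2 [y2I z2J ->]]]].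
  exists (l1 + l2)%N.
  exists (fun j => match fintype.split j with inl j1 => y1 j1 | inr j2 => y2 j2 end).
  exists (fun j => match fintype.split j with inl j1 => z1 j1 | inr j2 => z2 j2 end).
  split=> [j|j|]; [by case: (fintype.split j)|by case: (fintype.split j)|].
  rewrite big_split_ord /=; congr (_ + _); apply: eq_bigr => j _.
    by rewrite (unsplitK (inl j)).
  by rewrite (unsplitK (inr j)).
- exact: ideal_powMl.
Qed.

Lemma ideal_pow_le k k' : (k <= k')%N -> mpow k' `<=` mpow k.
Proof.
elim: k' => [|k' IH]; first by rewrite leqn0 => /eqP ->.
rewrite leq_eqVlt ltnS => /predU1P[-> //|/IH sub].
exact: subset_trans (@ideal_powS k') sub.
Qed.

HB.instance Definition _ := GRing.ComNzRing.on (adic m).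
HB.instance Definition _ := isPointed.Build (adic m) (0 : R).

Definition adic_open (U : set (adic m)) : Prop :=
  forall x : R, U x -> exists k, forall y : R, mpow k (y - x) -> U y.

Lemma adic_openT : adic_open setT.
Proof. by move=> x _; exists 0%N. Qed.

Lemma adic_openI A B : adic_open A -> adic_open B -> adic_open (A `&` B).
Proof.
move=> oA oB x [/oA[k kA] /oB[l lB]]; exists (maxn k l) => y xy.
split; [apply: kA|apply: lB]; apply: ideal_pow_le xy; [exact: leq_maxl|exact: leq_maxr].
Qed.

Lemma adic_open_bigcup (I : Type) (f : I -> set (adic m)) :
  (forall i, adic_open (f i)) -> adic_open (\bigcup_i f i).
Proof.
move=> fo x [i _ fix_]; have [k kf] := fo i x fix_.
by exists k => y /kf fy; exists i.
Qed.

HB.instance Definition _ :=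
  isOpenTopological.Build (adic m) adic_openT adic_openI adic_open_bigcup.

End AdicTopology.

Definition borel_mx (R : comNzRingType) (m : idealr R) (p q : nat) :=
  g_sigma_algebraType (@open 'M[adic m]_(p, q)).

(* A translation-invariant probability measure on the Borel sets of the
   compact group M_{p x q}(R), i.e. its normalized Haar measure. *)
Definition haar_probability (K : realType) (R : comNzRingType) (m : idealr R)
    (p q : nat) (mu : probability (borel_mx m p q) K) : Prop :=
  forall (Y : 'M[R]_(p, q)) (A : set (borel_mx m p q)), measurable A ->
    mu [set (Y + X : 'M[R]_(p, q)) | X in A] = mu A.

Definition cond_prob d (T : measurableType d) (K : realType)
    (mu : probability T K) (A B : set T) : K :=
  fine (mu (A `&` B)) / fine (mu B).

Definition lmod_iso (R : comNzRingType) (U V : lmodType R) : Prop :=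
  exists f : {linear U -> V}, bijective f.

Definition lmod_aut (R : comNzRingType) (V : lmodType R) : set (V -> V) :=
  [set f | linear f /\ bijective f].

Arguments lmod_aut {R} V.

Section QuotientModule.
Variables (R : comNzRingType) (V : lmodType R) (N : submodClosed V).

Definition submod_pred : {pred V} := N.

Lemma submod_pred_zmod_closed : zmod_closed submod_pred.
Proof.
split=> [|x y xN yN]; first exact: rpred0.
by apply: rpredD => //; rewrite -scaleN1r; apply: rpredZ.
Qed.

HB.instance Definition _ :=
  GRing.isZmodClosed.Build V submod_pred submod_pred_zmod_closed.

Definition quotmod : Type := Quotient.quot submod_pred.

HB.instance Definition _ := GRing.Zmodule.on quotmod.
HB.instance Definition _ := Quotient.on quotmod.

Definition quotmod_scale (a : R) (x : quotmod) : quotmod :=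
  \pi_quotmod (a *: repr x).

Lemma quotmod_eqP (x y : V) :
  reflect (\pi_quotmod x = \pi_quotmod y) (x - y \in N).
Proof.
rewrite -[x - y \in N]/(x - y \in submod_pred) Quotient.idealrBE.
exact: eqP.
Qed.

Lemma quotmod_piD (x y : V) :
  \pi_quotmod (x + y) = \pi_quotmod x + \pi_quotmod y.
Proof. exact: (raddfD \pi_(Quotient.quot submod_pred)). Qed.

Lemma quotmod_piZ a (x : V) :
  quotmod_scale a (\pi_quotmod x) = \pi_quotmod (a *: x).
Proof.
apply/quotmod_eqP; rewrite -scalerBr; apply: rpredZ.
by apply/quotmod_eqP; rewrite reprK.
Qed.

Lemma quotmod_surj (x : quotmod) : exists v, x = \pi_quotmod v.
Proof. by exists (repr x); rewrite reprK. Qed.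

Lemma quotmod_scalerA a b x :
  quotmod_scale a (quotmod_scale b x) = quotmod_scale (a * b) x.
Proof.
have [v ->] := quotmod_surj x.
by rewrite (quotmod_piZ b v) (quotmod_piZ a (b *: v)) (quotmod_piZ (a * b) v) scalerA.
Qed.

Lemma quotmod_scale1r : left_id 1 quotmod_scale.
Proof.
by move=> x; have [v ->] := quotmod_surj x; rewrite (quotmod_piZ 1 v) scale1r.
Qed.

Lemma quotmod_scalerDr : right_distributive quotmod_scale +%R.
Proof.
move=> a x y; have [u ->] := quotmod_surj x; have [v ->] := quotmod_surj y.
rewrite -quotmod_piD (quotmod_piZ a (u + v)) (quotmod_piZ a u) (quotmod_piZ a v).
by rewrite scalerDr quotmod_piD.
Qed.

Lemma quotmod_scalerDl x : {morph quotmod_scale^~ x : a b / a + b}.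
Proof.
move=> a b; have [v ->] := quotmod_surj x.
rewrite (quotmod_piZ (a + b) v) (quotmod_piZ a v) (quotmod_piZ b v).
by rewrite scalerDl quotmod_piD.
Qed.

HB.instance Definition _ := GRing.Zmodule_isLmodule.Build R quotmod
  quotmod_scalerA quotmod_scale1r quotmod_scalerDr quotmod_scalerDl.

End QuotientModule.

Section Cokernel.
Variables (R : comNzRingType) (p q : nat) (X : 'M[R]_(p, q)).

Definition colspan : {pred 'cV[R]_p} :=
  fun v => `[< exists w : 'cV[R]_q, v = X *m w >].

Lemma colspan_submod_closed : GRing.submod_closed colspan.
Proof.
split=> [|a u v /asboolP[x ->] /asboolP[y ->]]; apply/asboolP.
  by exists 0; rewrite mulmx0.
by exists (a *: x + y); rewrite mulmxDr scalemxAr.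
Qed.

HB.instance Definition _ :=
  GRing.isSubmodClosed.Build R 'cV[R]_p colspan colspan_submod_closed.

Definition cok : lmodType R := quotmod colspan.

End Cokernel.

Section Reduction.
Variables (R : comNzRingType) (a : idealr R) (G : lmodType R).

Definition idealmod : {pred G} :=
  fun x => `[< exists (l : nat) (c : 'I_l -> R) (g : 'I_l -> G),
     (forall j, c j \in a) /\ x = \sum_(j < l) c j *: g j >].

Lemma idealmod_submod_closed : GRing.submod_closed idealmod.
Proof.
split=> [|b u v /asboolP[l1 [c1 [g1 [c1a ->]]]] /asboolP[l2 [c2 [g2 [c2a ->]]]]];
  apply/asboolP.
  by exists 0%N, (fun=> 0), (fun=> 0); rewrite big_ord0; split=> //; case.
exists (l1 + l2)%N.
exists (fun j => match fintype.split j with inl j1 => b * c1 j1 | inr j2 => c2 j2 end).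
exists (fun j => match fintype.split j with inl j1 => g1 j1 | inr j2 => g2 j2 end).
split=> [j|]; first by case: (fintype.split j) => // i; apply: idealMr.
rewrite big_split_ord scaler_sumr /=; congr (_ + _); apply: eq_bigr => j _.
  by rewrite (unsplitK (inl j)) scalerA.
by rewrite (unsplitK (inr j)).
Qed.

HB.instance Definition _ :=
  GRing.isSubmodClosed.Build R G idealmod idealmod_submod_closed.

(* G / a G as an R-module; [redmod] below is the same group as an R/a-module. *)
Definition modmod : lmodType R := quotmod idealmod.

Definition redmod : Type := quotmod idealmod.

HB.instance Definition _ := GRing.Zmodule.on redmod.

Definition redmod_scale (r : {ideal_quot a}) (x : redmod) : redmod :=
  repr r *: (x : quotmod idealmod).

Lemma redmod_piZ (r : R) (x : redmod) :
  redmod_scale (\pi r) x = r *: (x : quotmod idealmod).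
Proof.
rewrite /redmod_scale; have [v ->] := quotmod_surj x.
rewrite [LHS](quotmod_piZ _ _ v) [RHS](quotmod_piZ _ r v).
apply/quotmod_eqP; rewrite -scalerBl; apply/asboolP.
exists 1%N, (fun=> repr (\pi_{ideal_quot a} r) - r), (fun=> v).
split; last by rewrite big_ord1.
by move=> _; rewrite Quotient.idealrBE reprK.
Qed.

Lemma redmod_scalerA r s x :
  redmod_scale r (redmod_scale s x) = redmod_scale (r * s) x.
Proof.
rewrite -[r]reprK -[s]reprK -rmorphM.
rewrite (redmod_piZ (repr r)) (redmod_piZ (repr s)) (redmod_piZ (repr r * repr s)).
exact: (@scalerA _ (quotmod idealmod)).
Qed.

Lemma redmod_scale1r : left_id 1 redmod_scale.
Proof.
move=> x; rewrite -(rmorph1 \pi_{ideal_quot a}) (redmod_piZ 1).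
exact: (@scale1r _ (quotmod idealmod)).
Qed.

Lemma redmod_scalerDr : right_distributive redmod_scale +%R.
Proof.
by move=> r x y; exact: (@scalerDr _ (quotmod idealmod)).
Qed.

Lemma redmod_scalerDl x : {morph redmod_scale^~ x : r s / r + s}.
Proof.
move=> r s; rewrite -[r]reprK -[s]reprK -rmorphD.
rewrite (redmod_piZ (repr r)) (redmod_piZ (repr s)) (redmod_piZ (repr r + repr s)).
exact: (@scalerDl _ (quotmod idealmod)).
Qed.

HB.instance Definition _ := GRing.Zmodule_isLmodule.Build {ideal_quot a} redmod
  redmod_scalerA redmod_scale1r redmod_scalerDr redmod_scalerDl.

End Reduction.

Arguments idealmod {R} a G.

Section Restriction.
Variables (R : comNzRingType) (a : idealr R) (M : lmodType {ideal_quot a}).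

Definition restr : Type := M.

HB.instance Definition _ := GRing.Zmodule.on restr.

Definition restr_scale (r : R) (x : restr) : restr :=
  (\pi_{ideal_quot a} r : {ideal_quot a}) *: (x : M).

Lemma restr_scalerA r s x :
  restr_scale r (restr_scale s x) = restr_scale (r * s) x.
Proof. by rewrite /restr_scale rmorphM scalerA. Qed.

Lemma restr_scale1r : left_id 1 restr_scale.
Proof. by move=> x; rewrite /restr_scale rmorph1 scale1r. Qed.

Lemma restr_scalerDr : right_distributive restr_scale +%R.
Proof. by move=> r x y; exact: scalerDr. Qed.

Lemma restr_scalerDl x : {morph restr_scale^~ x : r s / r + s}.
Proof. by move=> r s; rewrite /restr_scale rmorphD; exact: scalerDl. Qed.

HB.instance Definition _ := GRing.Zmodule_isLmodule.Build R restr
  restr_scalerA restr_scale1r restr_scalerDr restr_scalerDl.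

End Restriction.

Section ResidueField.
Variables (R : comNzRingType) (m : maxIdealr R).

Definition residue_field : Type := {ideal_quot m}.

HB.instance Definition _ := GRing.ComNzRing.on residue_field.

Definition residue : {rmorphism R -> residue_field} := \pi_{ideal_quot m}.

Lemma residue_eq0 x : (residue x == 0) = (x \in m).
Proof. by rewrite -(rmorph0 residue) -Quotient.idealrBE subr0. Qed.

Lemma maxideal_inv x : x \notin m -> exists y, residue (y * x) = 1.
Proof.
move=> xm.
pose J : {pred R} := fun z => `[< exists u v, v \in m /\ z = u * x + v >].
have [J1|J1] := boolP (1 \in J).
  have /asboolP[u [v [vm uv]]] := J1; exists u.
  have -> : u * x = 1 - v by rewrite uv addrK.
  by move: vm; rewrite rmorphB rmorph1 -residue_eq0 => /eqP ->; rewrite subr0.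
have Jid : idealr_closed J.
  split=> // [|b u v /asboolP[u1 [v1 [v1m ->]]] /asboolP[u2 [v2 [v2m ->]]]].
    by apply/asboolP; exists 0, 0; rewrite mul0r addr0; split=> //; exact: rpred0.
  apply/asboolP; exists (b * u1 + u2), (b * v1 + v2); split.
    by apply: rpredD => //; apply: idealMr.
  by rewrite mulrDr mulrDl mulrA addrACA.
pose Ji := isIdealr.Build R J Jid.
pose JI : idealr R := HB.pack J Ji.
have mJ : {subset m <= JI}.
  by move=> v vm; apply/asboolP; exists 0, v; rewrite mul0r add0r.
have /negP[] := xm; apply: (@max_ideal_subproof R m JI mJ x).
by apply/asboolP; exists 1, 0; rewrite mul1r addr0; split=> //; exact: rpred0.
Qed.

Lemma residue_field_inv (x : residue_field) :
  exists y, if x == 0 then y = 0 else y * x = 1.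
Proof.
case: eqVneq => [_|x0]; first by exists 0.
move: x0; rewrite -[x](@reprK _ {ideal_quot m}).
rewrite [_ == _](residue_eq0 (repr (x : {ideal_quot m}))).
by move=> /maxideal_inv[y yx]; exists (residue y); rewrite -yx rmorphM.
Qed.

Definition residue_field_invr (x : residue_field) : residue_field :=
  projT1 (cid (residue_field_inv x)).

Lemma residue_field_mulVf (x : residue_field) :
  x != 0 -> residue_field_invr x * x = 1.
Proof. by rewrite /residue_field_invr; case: cid => y /=; case: eqVneq. Qed.

Lemma residue_field_invr0 : residue_field_invr 0 = 0.
Proof. by rewrite /residue_field_invr; case: cid => y /=; rewrite eqxx. Qed.

HB.instance Definition _ := GRing.ComNzRing_isField.Build residue_field
  residue_field_mulVf residue_field_invr0.

End ResidueField.

Section MaxIdealQuotient.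
Variables (R : comNzRingType) (a : idealr R) (m : maxIdealr R).
Hypothesis am : {subset a <= m}.

Definition quot_maxideal_pred : {pred {ideal_quot a}} :=
  fun x => `[< exists2 y, y \in m & x = \pi y >].

Lemma quot_maxideal_piE (y : R) : (\pi y \in quot_maxideal_pred) = (y \in m).
Proof.
apply/asboolP/idP => [[z zm /eqP]|ym]; last by exists y.
rewrite -Quotient.idealrBE => /am yz.
by rewrite -(subrK z y); apply: rpredD.
Qed.

Lemma quot_maxideal_closed : idealr_closed quot_maxideal_pred.
Proof.
split=> [||b u v].
- by rewrite -(rmorph0 \pi_{ideal_quot a}) quot_maxideal_piE; exact: rpred0.
- by rewrite -(rmorph1 \pi_{ideal_quot a}) quot_maxideal_piE idealr1.
rewrite -[b]reprK -[u]reprK -[v]reprK -rmorphM -rmorphD !quot_maxideal_piE.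
by move=> um vm; apply: rpredD => //; apply: idealMr.
Qed.

Lemma quot_maxideal_max (J : idealr {ideal_quot a}) :
  {subset quot_maxideal_pred <= J} -> {subset J <= quot_maxideal_pred}.
Proof.
move=> mJ.
pose I : {pred R} := fun y => (\pi_{ideal_quot a} y \in J).
have inI y : (y \in I) = (\pi_{ideal_quot a} y \in J) by [].
have Iid : idealr_closed I.
  split=> [||b u v].
  - by rewrite inI rmorph0; exact: rpred0.
  - by rewrite inI rmorph1 idealr1.
  rewrite !inI rmorphD rmorphM => uJ vJ.
  by apply: rpredD => //; apply: idealMr.
pose Ii := isIdealr.Build R I Iid.
pose II : idealr R := HB.pack I Ii.
have mI : {subset m <= II}.
  by move=> y ym; apply: mJ; rewrite quot_maxideal_piE.
move=> x; rewrite -[x]reprK quot_maxideal_piE => xJ.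
exact: (@max_ideal_subproof R m II mI _ xJ).
Qed.

Definition quot_maxideal : maxIdealr {ideal_quot a} :=
  HB.pack quot_maxideal_pred
    (isIdealr.Build _ quot_maxideal_pred quot_maxideal_closed)
    (isMaxIdeal.Build _ quot_maxideal_pred quot_maxideal_max).

End MaxIdealQuotient.

(* A resolution ... -> S^(r 2) -> S^(r 1) -> S^(r 0) -> M -> 0 by finite free
   modules; elements are row vectors and the differential
   S^(r i.+1) -> S^(r i) is v |-> v *m d i. *)
Record free_resolution (S : comNzRingType) (M : lmodType S) := FreeResolution {
  res_rank : nat -> nat;
  res_diff : forall i, 'M[S]_(res_rank i.+1, res_rank i);
  res_aug : {linear 'rV[S]_(res_rank 0) -> M};
  res_aug_surj : forall x, exists v, res_aug v = x;
  res_exact0 : forall v, res_aug v = 0 <-> exists w, v = w *m res_diff 0;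
  res_exact : forall i (v : 'rV[S]_(res_rank i.+1)),
    v *m res_diff i = 0 <-> exists w, v = w *m res_diff i.+1
}.

(* With k = S/m: the differentials of F (x) k are the residues of those of F,
   and Tor_i^S(M, k) = H_i(F (x) k) has dimension
   dim ker (F_i (x) k -> F_(i-1) (x) k) - dim im (F_(i+1) (x) k -> F_i (x) k),
   where F_(-1) = 0. *)
Definition res_diff_residue (S : comNzRingType) (m : maxIdealr S)
    (M : lmodType S) (F : free_resolution M) (i : nat) :
    'M[residue_field m]_(res_rank F i.+1, res_rank F i) :=
  map_mx (residue m) (res_diff F i).

Definition tor_dim (S : comNzRingType) (m : maxIdealr S) (M : lmodType S)
    (F : free_resolution M) (i : nat) : nat :=
  ((if i is j.+1 then \rank (kermx (res_diff_residue m F j)) else res_rank F 0)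
   - \rank (res_diff_residue m F i))%N.

(* beta_i^S(M) = dim_k Tor_i^S(M, k). The number is read off any resolution of
   M by finite free modules (one exists for M finitely generated over a
   Noetherian S, and the result is independent of it). *)
Definition betti (S : comNzRingType) (m : maxIdealr S) (M : lmodType S)
    (i : nat) : nat :=
  xget 0%N [set b | exists F : free_resolution M, b = tor_dim m F i].

(* Main.v *)
(* For a surjection g : R^n -> G with kernel K, cok(X) = G via g exactly when
   the columns of X lie in K and span K / mK (Nakayama). So count the maps g
   whose kernel reduces to the column span of Xbar: there are
   |Aut(G/aG)| |aG|^n of them, and the kernels are their Aut(G)-orbits. For one
   such g, given X = Xbar mod a, the columns fall in K with probability
   |aG|^-(n+u); their classes in V = K / mK are then uniform in cosets of the
   image W of K \cap a^n, and span V / W already. By Schanuel's lemma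
   dim V = b1 + n - b0 and dim V / W = b1' + n - b0, so the proportion of
   (n+u)-tuples that span V is the product of the statement. All events are
   unions of cosets of some power of m, so only translation invariance of the
   measure is used. *)
Require Import Defs.
From HB Require Import structures.
From mathcomp Require Import all_boot all_order all_algebra generic_quotient ring_quotient finmap.
From mathcomp Require Import all_classical all_reals all_analysis.
From mathcomp Require Import zify ring.

Set Implicit Arguments.
Unset Strict Implicit.
Unset Printing Implicit Defensive.

Import Order.TTheory GRing.Theory Num.Theory.

Local Open Scope ring_scope.
Local Open Scope quotient_scope.
Local Open Scope classical_set_scope.

(** * Cardinality of finite sets *)

Section Ncard.
Implicit Types T U : choiceType.

(** The answer is free of n because n cancels twice. The count of maps brings $|aG|^n$ and the
    columns bring $|aG|^{-(n+u)}$, which leaves $|aG|^{-u}$; and the proportion of spanning tuples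
    depends only on the differences between the number n + u of columns and the dimensions of V and
    V / W, each of which is n plus a constant. The maps counted are not assumed onto: since aG lies
    in mG, Nakayama's lemma makes them so. Two obstacles shape the rest. [betti] reads each degree
    off an arbitrary resolution, so b0 and b1 may come from different ones and have to be tied to
    the kernel of a given g. And the residue fields of R and R/a are distinct types, so dim V / W,
    computed over the first, and b1', computed over the second, are compared by carrying generators
    across. Hence K / mK is never formed: [res_coord] keeps only coordinates on it, in the same form
    for both rings. *)

Lemma ncard_seq T (A : set T) (s : seq T) :
  uniq s -> (forall x, A x <-> x \in s) -> ncard A = size s.
Proof.
move=> us As; have -> : A = [set` s] by apply/seteqP; split=> x /As.
apply/perm_size/uniq_perm => //.
move=> x; rewrite (in_fset_set (finite_seq s)).
by apply/idP/idP; rewrite inE.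
Qed.

Lemma ncardE T (A : set T) : finite_set A ->
  exists s : seq T, [/\ uniq s, forall x, A x <-> x \in s & ncard A = size s].
Proof.
move=> Afin; exists (fset_set A); split=> //= x.
by rewrite (in_fset_set Afin); split; rewrite inE.
Qed.

Lemma ncard_fin (T : finType) (A : {pred T}) : ncard [set` A] = #|A|.
Proof. by rewrite cardE; apply: ncard_seq (enum_uniq _) _ => x; rewrite mem_enum. Qed.

Lemma ncard_image T U (f : T -> U) (A : set T) :
  finite_set A -> {in A &, injective f} -> ncard (f @` A) = ncard A.
Proof.
move=> Afin inj; apply/fcard_eq => //; first exact: finite_image.
exact: inj_card_eq.
Qed.

Lemma ncard_gt0 T (A : set T) x : finite_set A -> A x -> (0 < ncard A)%N.
Proof.
by move=> Afin Ax; rewrite cardfs_gt0; apply/fset0Pn; exists x; rewrite in_fset_set ?inE.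
Qed.

Lemma ncard_ltn T (A B : set T) x :
  finite_set B -> A `<=` B -> B x -> ~ A x -> (ncard A < ncard B)%N.
Proof.
move=> Bfin AB Bx Ax; have Afin := sub_finite_set AB Bfin.
have sAB : (fset_set A `<=` fset_set B)%fset by rewrite -fset_set_sub.
apply: fproper_ltn_card; rewrite fproperEneq sAB andbT.
by apply: contra_not_neq Ax => /(fset_set_inj Afin Bfin) ->.
Qed.

Lemma ncard_fiber T U (f : T -> U) (A : set T) (B : set U) c :
  finite_set A -> finite_set B -> (forall x, A x -> B (f x)) ->
  (forall y, B y -> ncard (A `&` f @^-1` [set y]) = c) ->
  ncard A = (ncard B * c)%N.
Proof.
move=> Afin Bfin AB fib.
have [s [us sA ->]] := ncardE Afin; have [t [ut tB ->]] := ncardE Bfin.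
have -> : size s = (\sum_(y <- t) \sum_(x <- s) (f x == y))%N.
  rewrite exchange_big /= -sum1_size big_seq [RHS]big_seq; apply: eq_bigr => x /sA/AB/tB xt.
  rewrite (bigD1_seq (f x)) //= eqxx big1 // => y.
  by rewrite eq_sym => /negbTE ->.
rewrite big_seq (eq_bigr (fun=> c)) => [|y /tB By].
  by rewrite -big_seq big_const_seq count_predT iter_addn_0 mulnC.
rewrite -(fib y By) (@ncard_seq _ _ [seq x <- s | f x == y]).
- by rewrite size_filter -sum1_count [RHS]big_mkcond; apply: eq_bigr => x _; case: eqP.
- exact: filter_uniq.
- move=> x; rewrite mem_filter; split=> [[/sA -> ->]|/andP[/eqP <- /sA]]; first by rewrite eqxx.
  by [].
Qed.

Lemma ncard_ffun T (D : set T) (I : finType) : finite_set D ->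
  finite_set [set v : {ffun I -> T} | forall j, D (v j)] /\
  ncard [set v : {ffun I -> T} | forall j, D (v j)] = (ncard D ^ #|I|)%N.
Proof.
move=> Dfin; pose X := fset_set D.
pose f (v : {ffun I -> X}) : {ffun I -> T} := [ffun j => val (v j)].
have -> : [set v : {ffun I -> T} | forall j, D (v j)] = f @` [set` predT].
  apply/seteqP; split=> [v Dv|_ [v _ <-] j] /=; last first.
    by rewrite ffunE; have := fsvalP (v j); rewrite in_fset_set // inE.
  have vX j : v j \in X by rewrite in_fset_set // inE.
  exists [ffun j => FSetSub (vX j)] => //; apply/ffunP => j; rewrite !ffunE.
  by [].
have fin : finite_set ([set` predT] : set {ffun I -> X}) by exact: finite_finset.
split; first exact: finite_image.
rewrite ncard_image //; last first.
  by move=> v w _ _ /ffunP vw; apply/ffunP => j; have := vw j; rewrite !ffunE => /val_inj.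
by rewrite ncard_fin cardT -cardE card_ffun -cardfE.
Qed.

Lemma ncard_mx T p q : finite_set [set: T] ->
  finite_set [set: 'M[T]_(p, q)] /\ ncard [set: 'M[T]_(p, q)] = (ncard [set: T] ^ (p * q))%N.
Proof.
move=> Tfin; have [fin cE] := ncard_ffun ('I_p * 'I_q)%type Tfin.
pose D : set {ffun 'I_p * 'I_q -> T} := [set v | forall j, [set: T] (v j)].
pose f (v : {ffun 'I_p * 'I_q -> T}) := \matrix_(i, j) v (i, j).
have -> : [set: 'M[T]_(p, q)] = f @` D.
  apply/seteqP; split=> // A _; exists [ffun ij => A ij.1 ij.2] => //.
  by apply/matrixP => i j; rewrite mxE ffunE.
split; first exact: finite_image.
rewrite ncard_image // ?cE ?card_prod ?card_ord // => v w _ _ /matrixP vw.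
by apply/ffunP => -[i j]; have := vw i j; rewrite !mxE.
Qed.

Lemma finite_mx T p q : finite_set [set: T] -> finite_set [set: 'M[T]_(p, q)].
Proof. by move=> /(ncard_mx p q)[]. Qed.

End Ncard.

(** * Modules over a local ring *)

Definition submod (S : comNzRingType) (V : lmodType S) (P : set V) : Prop :=
  P 0 /\ forall a x y, P x -> P y -> P (a *: x + y).

Lemma submod_sum (S : comNzRingType) (V : lmodType S) (P : set V) r (F : 'I_r -> V) :
  submod P -> (forall i, P (F i)) -> P (\sum_i F i).
Proof.
move=> [P0 PS] PF; elim/big_rec: _ => // i y _ Py.
by rewrite -[F i]scale1r; exact: PS.
Qed.

Section LinearCombination.
Variables (S : comNzRingType) (V : lmodType S) (r : nat) (x : 'I_r -> V).

(** A tuple stands for the linear map from $S^r$ that sends the standard basis to it; maps into a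
    finite module thereby form a finite set of tuples. *)
Definition lc (c : 'rV[S]_r) : V := \sum_i c 0 i *: x i.

Lemma lc_is_linear : linear lc.
Proof.
move=> a u v; rewrite /lc scaler_sumr -big_split; apply: eq_bigr => i _.
by rewrite !mxE scalerDl scalerA.
Qed.

HB.instance Definition _ := GRing.isLinear.Build S 'rV[S]_r V *:%R lc lc_is_linear.

Lemma lc_delta i : lc (delta_mx 0 i) = x i.
Proof.
rewrite /lc (bigD1 i) //= mxE !eqxx scale1r big1 ?addr0 // => j ji.
by rewrite mxE (negbTE ji) andbF scale0r.
Qed.

Lemma submod_lc (P : set V) c : submod P -> (forall i, P (x i)) -> P (lc c).
Proof.
move=> [P0 PS] Px; rewrite /lc; elim/big_rec: _ => // i y _ Py.
exact: PS.
Qed.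

End LinearCombination.

Lemma linear_lc (S : comNzRingType) (U V : lmodType S) (f : {linear U -> V}) r
    (x : 'I_r -> U) c : f (lc x c) = lc (f \o x) c.
Proof. by rewrite /lc linear_sum; apply: eq_bigr => i _; rewrite linearZ. Qed.

Lemma rV_lc (S : comNzRingType) (V : lmodType S) n (f : {linear 'rV[S]_n -> V}) v :
  f v = lc (fun i => f (delta_mx 0 i)) v.
Proof.
rewrite {1}(row_sum_delta v) linear_sum; apply: eq_bigr => i _.
by rewrite linearZ.
Qed.

Lemma mulmx_lc (S : comNzRingType) r n (c : 'rV[S]_r) (A : 'M[S]_(r, n)) :
  c *m A = lc (fun i => row i A) c.
Proof. exact: mulmx_sum_row. Qed.

Lemma row_full_surj (k : fieldType) p q (A : 'M[k]_(p, q)) :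
  (forall w : 'rV[k]_q, exists c, w = c *m A) -> row_full A.
Proof.
move=> surj; have /choice[c cE] : forall i, exists c, row i 1%:M = c *m A.
  by move=> i; exact: surj.
apply/row_fullP; exists (\matrix_i c i); apply/row_matrixP => i.
by rewrite row_mul rowK -cE.
Qed.

Section ResidueCoordinates.
Variables (S : comNzRingType) (mS : maxIdealr S).
Local Notation k := (residue_field mS).
Local Notation rho := (residue mS).

(** The condition on the maximal ideal that makes Nakayama's lemma work; it passes from R to R/a. *)
Definition in_jacobson : Prop := forall x, x \in mS -> exists y, y * (1 - x) = 1.

Lemma residue_surj (x : k) : exists y, rho y = x.
Proof. by exists (repr (x : {ideal_quot mS})); exact: reprK. Qed.

Lemma residue_mx_surj p q (A : 'M[k]_(p, q)) : exists B, map_mx rho B = A.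
Proof.
have [f fE] := choice residue_surj.
by exists (map_mx f A); apply/matrixP => i j; rewrite !mxE fE.
Qed.

(** The determinant is 1 modulo the ideal, hence invertible, and the adjugate gives the inverse. *)
Lemma residue_mx1_left_inv n (E : 'M[S]_n) :
  in_jacobson -> map_mx rho E = 1%:M -> exists D, D *m E = 1%:M.
Proof.
move=> jac E1.
have : 1 - \det E \in mS.
  by rewrite -residue_eq0 rmorphB rmorph1 -det_map_mx E1 det1 subrr.
move=> /jac[y]; rewrite subKr => yE.
by exists (y *: \adj E); rewrite -scalemxAl mul_adj_mx scale_scalar_mx yE.
Qed.

(* [tau] identifies P / mP with k^d; the last clause is Nakayama's lemma for
   the finitely generated module P. *)
Definition res_coord (V : lmodType S) (P : set V) d (tau : V -> 'rV[k]_d) : Prop :=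
  [/\ forall a x y, P x -> P y -> tau (a *: x + y) = rho a *: tau x + tau y,
      forall w, exists2 x, P x & tau x = w
    & forall r (x : 'I_r -> V), (forall i, P (x i)) ->
        row_full (\matrix_i tau (x i)) -> forall y, P y -> exists c, y = lc x c].

Section Theory.
Variables (V : lmodType S) (P : set V) (d : nat) (tau : V -> 'rV[k]_d).
Hypotheses (Psub : submod P) (Ptau : res_coord P tau).

Lemma res_coord0 : tau 0 = 0.
Proof.
have [lin _ _] := Ptau; have [P0 _] := Psub.
have := lin 1 0 0 P0 P0; rewrite scale1r add0r rmorph1 scale1r => /eqP.
by rewrite -subr_eq0 opprD addNKr oppr_eq0 => /eqP.
Qed.

Lemma res_coord_lc r (x : 'I_r -> V) c : (forall i, P (x i)) ->
  tau (lc x c) = map_mx rho c *m \matrix_i tau (x i).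
Proof.
move=> Px; rewrite mulmx_sum_row.
have [lin _ _] := Ptau; have [P0 PS] := Psub.
suff [] : P (lc x c) /\ tau (lc x c) =
   \sum_i map_mx rho c 0 i *: row i (\matrix_i tau (x i)) by [].
rewrite /lc; elim/big_rec2: _ => [|i y z _ [Pz tz]]; first by rewrite res_coord0.
by split; [exact: PS|rewrite lin // tz mxE rowK].
Qed.

Lemma res_coord_gens : exists x : 'I_d -> V, (forall i, P (x i)) /\
  \matrix_i tau (x i) = 1%:M.
Proof.
have [_ surj _] := Ptau.
have /choice[x xE] : forall i : 'I_d, exists x, P x /\ tau x = row i 1%:M.
  by move=> i; have [x Px tx] := surj (row i 1%:M); exists x.
exists x; split=> [i|]; first by case: (xE i).
by apply/row_matrixP => i; rewrite rowK; case: (xE i).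
Qed.

(** Generation is asked only after [tau], that is modulo mP; with the Nakayama clause of [res_coord]
    it becomes generation of P. *)
Lemma res_coord_full r (x : 'I_r -> V) : (forall i, P (x i)) ->
  (forall y, P y -> exists c, tau y = tau (lc x c)) ->
  row_full (\matrix_i tau (x i)).
Proof.
move=> Px gen; have [z [Pz tz]] := res_coord_gens.
apply/row_fullP.
have /choice[c cE] : forall i, exists c, tau (z i) = tau (lc x c).
  by move=> i; exact: gen.
exists (\matrix_i map_mx rho (c i)); rewrite -tz; apply/row_matrixP => i.
by rewrite row_mul !rowK cE res_coord_lc.
Qed.

Lemma res_coord_leq r (x : 'I_r -> V) : (forall i, P (x i)) ->
  (forall y, P y -> exists c, tau y = tau (lc x c)) -> (d <= r)%N.
Proof.
move=> Px gen; have := res_coord_full Px gen.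
by rewrite /row_full => /eqP <-; exact: rank_leq_row.
Qed.

End Theory.

(** A lift of the standard basis along [tau'] generates P by Nakayama, which bounds d by d'. *)
Lemma res_coord_uniq (V : lmodType S) (P : set V) d d' (tau : V -> 'rV[k]_d)
    (tau' : V -> 'rV[k]_d') :
  submod P -> res_coord P tau -> res_coord P tau' -> d = d'.
Proof.
move=> Psub; wlog suff wl : d d' tau tau' / res_coord P tau ->
    res_coord P tau' -> (d <= d')%N.
  by move=> t t'; apply/eqP; rewrite eqn_leq (wl _ _ _ _ t t') (wl _ _ _ _ t' t).
move=> t t'; have [x [Px tx]] := res_coord_gens t'.
apply: (res_coord_leq Psub t Px) => y Py.
have [_ _ nak] := t'.
by have [|c ->] := nak _ x Px _ y Py; [rewrite tx /row_full mxrank1|exists c].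
Qed.

(** P is presented by [f] and [B], so P / mP is $k^r$ modulo the row space of [Bk]; the columns of
    [C], a basis of the column space of [cokermx Bk], give coordinates on it. *)
Lemma res_coord_presentation (V : lmodType S) (P : set V) r r' d
    (f : {linear 'rV[S]_r -> V}) (B : 'M[S]_(r', r)) :
  in_jacobson -> (forall y, P y <-> exists v, f v = y) ->
  (forall v, f v = 0 <-> exists w, v = w *m B) ->
  d = (r - \rank (map_mx rho B))%N ->
  exists tau : V -> 'rV[k]_d, res_coord P tau.
Proof.
move=> jac imf kerf; rewrite -mxrank_coker => ->.
set Bk := map_mx rho B; pose C := col_base (cokermx Bk).
have BC : Bk *m C = 0.
  have /row_freeP[Q rQ] := row_base_free (cokermx Bk).
  by rewrite -[_ *m C]mulmx1 -rQ -mulmxA [C *m _]mulmxA mulmx_base mulmxA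
    mulmx_coker mul0mx.
have kerC (v : 'rV_r) : v *m C = 0 -> exists w, v = w *m Bk.
  move=> vC; suff /submxP[w ->] : (v <= Bk)%MS by exists w.
  by rewrite submxE -(mulmx_base (cokermx Bk)) mulmxA vC mul0mx.
pose tau y := map_mx rho (xget 0 [set v | f v = y]) *m C.
have tauE v : tau (f v) = map_mx rho v *m C.
  rewrite /tau; have : f (xget 0 [set u | f u = f v]) = f v.
    by apply: (@xgetPex _ 0 [set u | f u = f v]); exists v.
  move: (xget _ _) => u fu; apply/eqP; rewrite -subr_eq0 -mulmxBl -map_mxB.
  have /kerf[w ->] : f (u - v) = 0 by rewrite linearB /= fu subrr.
  by rewrite map_mxM /= -mulmxA BC mulmx0.
exists tau; split=> [a x y /imf[u <-] /imf[v <-]|w|s x Px full y /imf[v <-]].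
- by rewrite -linearP !tauE map_mxD map_mxZ mulmxDl scalemxAl.
- have /row_fullP[D DC] : row_full C by exact: col_base_full.
  have [v vE] := residue_mx_surj (w *m D).
  exists (f v); first by apply/imf; exists v.
  by rewrite tauE vE -mulmxA DC mulmx1.
have /choice[v' v'E] : forall i, exists v, f v = x i by move=> i; apply/imf.
pose X := \matrix_i v' i.
have XE : \matrix_i tau (x i) = map_mx rho X *m C.
  apply/row_matrixP => i; rewrite row_mul rowK -v'E tauE; congr (_ *m _).
  by apply/rowP => j; rewrite !mxE.
have /row_fullP[c0 cE] := full; have [c cc] := residue_mx_surj (C *m c0).
(* [c] expresses the standard basis through the rows of [X] only modulo the row space of [Bk].
   Adding combinations of the rows of [B], which [f] kills, corrects it to a matrix that is the
   identity modulo the ideal, hence invertible. *)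
have [b0 bE] : exists b0, 1%:M - map_mx rho (c *m X) = b0 *m Bk.
  apply/submxP; rewrite submxE -(mulmx_base (cokermx Bk)) mulmxA -/C.
  by rewrite mulmxBl mul1mx map_mxM cc -!mulmxA -XE cE mulmx1 subrr mul0mx.
have [b bb] := residue_mx_surj b0.
have [|D DE] := @residue_mx1_left_inv _ (c *m X + b *m B) jac.
  by rewrite map_mxD [map_mx rho (b *m B)]map_mxM bb -bE addrC subrK.
exists (v *m D *m c).
have {1}-> : v = v *m D *m c *m X + v *m D *m b *m B.
  by rewrite -!mulmxA -!mulmxDr DE mulmx1.
rewrite linearD /= [X in _ + X](_ : _ = 0) ?addr0; last by apply/kerf; eexists.
rewrite mulmx_lc linear_lc; congr (lc _ _); apply/funext => i /=.
by rewrite rowK v'E.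
Qed.

End ResidueCoordinates.

(** * Free resolutions and Betti numbers *)

(** The common ground of the Noetherian ring R and the finite ring R/a, from which free resolutions
    are built over either. *)
Definition fg_submodules (S : comNzRingType) : Prop :=
  forall n (P : set 'rV[S]_n), submod P ->
    exists r (A : 'M[S]_(r, n)), forall x, P x <-> exists w, x = w *m A.

Lemma fg_submodules_finite (S : comNzRingType) :
  finite_set [set: S] -> fg_submodules S.
Proof.
move=> Sfin n P Psub.
have /finite_seqP[s Ps] : finite_set P.
  by apply: sub_finite_set (finite_mx 1 n Sfin).
exists (size s), (\matrix_(i < size s) s`_i) => x; split=> [|[w ->]].
  rewrite Ps /= => xs; have ixs : (index x s < size s)%N by rewrite index_mem.
  exists (delta_mx 0 (Ordinal ixs)).
  by rewrite -rowE rowK nth_index.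
rewrite mulmx_lc; apply: submod_lc => // i.
by rewrite rowK Ps /= mem_nth.
Qed.

(** [idealr] means proper ideal, so the unit ideal is treated apart, with generator 1. *)
Lemma noetherian_fg_ideal (S : comNzRingType) (I : set S) : noetherian S ->
  I 0 -> (forall a x y, I x -> I y -> I (a * x + y)) ->
  exists r (g : 'I_r -> S), forall x, I x <-> exists c : 'I_r -> S, x = \sum_i c i * g i.
Proof.
move=> noeth I0 IS; have [I1|I1] := pselect (I 1).
  exists 1%N, (fun=> 1) => x; split=> [Ix|_].
    by exists (fun=> x); rewrite big_ord1 mulr1.
  by rewrite -[x]mulr1 -[_ * 1]addr0; apply: IS.
pose J : {pred S} := fun x => `[< I x >].
have Jid : idealr_closed J.
  split=> [||b x y /asboolP Ix /asboolP Iy]; first exact/asboolP.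
    by apply/asboolP.
  by apply/asboolP/IS.
pose JI : idealr S := HB.pack J (isIdealr.Build S J Jid).
have [r [g gE]] := noeth JI; exists r, g => x; rewrite -gE.
by split=> [Ix|/asboolP]; first exact/asboolP.
Qed.

(** Induction along $0 \to P \cap S^n \to P \to I \to 0$, where I is the ideal of first coordinates
    of elements of P. *)
Lemma fg_submodules_noetherian (S : comNzRingType) :
  noetherian S -> fg_submodules S.
Proof.
move=> noeth; elim=> [|n IH] P [P0 PS].
  by exists 0%N, 0 => x; rewrite [x]thinmx0; split=> // _; exists 0; rewrite mul0mx.
pose P' : set 'rV[S]_(1 + n) := P.
pose I : set S := [set b | exists2 v, P' v & lsubmx v 0 0 = b].
have [| |r [g gE]] := @noetherian_fg_ideal S I noeth.
- by exists 0 => //; rewrite !mxE.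
- move=> b x y [v Pv <-] [w Pw <-]; exists (b *: v + w); first exact: PS.
  by rewrite !mxE.
have /choice[v vE] : forall i, exists v, P' v /\ lsubmx v 0 0 = g i.
  move=> i; have [w Pw wE] : I (g i).
    apply/gE; exists (fun j => (j == i)%:R).
    rewrite (bigD1 i) //= eqxx mul1r big1 ?addr0 // => j /negbTE ->.
    by rewrite mul0r.
  by exists w.
have [|r' [A AE]] := IH [set x : 'rV_n | P' (row_mx 0 x)].
  split=> [|b x y /= Px Py]; first by rewrite /= row_mx0.
  have -> : row_mx 0 (b *: x + y) = b *: row_mx 0 x + row_mx 0 y :> 'rV[S]_(1 + n).
    by rewrite scale_row_mx add_row_mx scaler0 addr0.
  exact: PS.
pose V : 'M[S]_(r, 1 + n) := \matrix_i v i.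
have PV c : P' (c *m V).
  rewrite mulmx_lc; apply: submod_lc => // i.
  by rewrite rowK; case: (vE i).
pose A1 : 'M[S]_(r', 1 + n) := row_mx 0 A.
have A1E w : w *m A1 = row_mx 0 (w *m A) :> 'rV_(1 + n) by rewrite mul_mx_row mulmx0.
pose B : 'M[S]_(r + r', 1 + n) := col_mx V A1.
have BE (w : 'rV_(r + r')) : w *m B = lsubmx w *m V + row_mx 0 (rsubmx w *m A).
  by rewrite -{1}[w]hsubmxK mul_row_col A1E.
exists (r + r')%N, B => x; split=> [Px|[w ->]].
  have /gE[c cE] : I (lsubmx (x : 'rV_(1 + n)) 0 0) by exists x.
  pose c' := \row_i c i; pose y := (x : 'rV_(1 + n)) - c' *m V.
  have y0 : lsubmx y = 0.
    have cV : lsubmx (c' *m V) 0 0 = lsubmx (x : 'rV_(1 + n)) 0 0.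
      rewrite cE !mxE; apply: eq_bigr => j _.
      by have [_ <-] := vE j; rewrite !mxE.
    by apply/rowP => i; rewrite (ord1 i) [RHS]mxE /y linearB /= mxE [X in _ + X]mxE cV subrr.
  have Py : P' y.
    by rewrite /y -scaleN1r addrC; apply: PS; first exact: PV.
  have [w wE] : exists w, rsubmx y = w *m A.
    by apply/AE; rewrite /= -y0 hsubmxK.
  exists (row_mx c' w); apply: etrans (esym (BE _)).
  by rewrite row_mxKl row_mxKr -wE -y0 hsubmxK addrC subrK.
suff : P' (w *m B) by [].
rewrite BE -[lsubmx w *m V]scale1r; apply: PS; first exact: PV.
by apply/AE; exists (rsubmx w).
Qed.

Lemma fg_kernel (S : comNzRingType) (V : lmodType S) r (f : {linear 'rV[S]_r -> V}) :
  fg_submodules S ->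
  exists r' (B : 'M[S]_(r', r)), forall v, f v = 0 <-> exists w, v = w *m B.
Proof.
move=> fg; apply: (fg _ [set v | f v = 0]); split=> [|a x y /= fx fy].
  exact: linear0.
by rewrite linearP fx fy scaler0 addr0.
Qed.

Lemma free_resolution_exists (S : comNzRingType) (M : lmodType S) r
    (f : {linear 'rV[S]_r -> M}) :
  fg_submodules S -> (forall x, exists v, f v = x) -> inhabited (free_resolution M).
Proof.
move=> fg fsurj; have [r1 [B0 B0E]] := fg_kernel f fg.
have syz p q (A : 'M[S]_(p, q)) : exists B : {s & 'M[S]_(s, p)},
    forall v : 'rV_p, v *m A = 0 <-> exists w, v = w *m projT2 B.
  have [s [B BE]] := fg_kernel (mulmxr A) fg.
  by exists (existT (fun s => 'M[S]_(s, p)) s B) => v; exact: BE.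
pose nx p q (A : 'M[S]_(p, q)) := projT1 (cid (syz p q A)).
have nxE p q (A : 'M[S]_(p, q)) (v : 'rV_p) : v *m A = 0 <-> exists w, v = w *m projT2 (nx p q A).
  by rewrite /nx; case: cid.
(* Each differential is packed with its sizes. The column count of stage [i.+1] is by computation
   the row count of stage [i], so consecutive differentials compose without casts. *)
pose st := fix st (i : nat) : {q & {p & 'M[S]_(p, q)}} :=
  if i is j.+1
  then existT (fun q => {p & 'M[S]_(p, q)}) (projT1 (projT2 (st j))) (nx _ _ (projT2 (projT2 (st j))))
  else existT _ r (existT _ r1 B0).
constructor.
exact: (@FreeResolution S M (fun i => projT1 (st i)) (fun i => projT2 (projT2 (st i)))
  f fsurj B0E (fun i v => nxE _ _ (projT2 (projT2 (st i))) v)).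
Qed.

Section Betti.
Variables (S : comNzRingType) (mS : maxIdealr S).
Local Notation k := (residue_field mS).
Local Notation rho := (residue mS).
Hypothesis jac : in_jacobson mS.

Lemma linear_lift (M : lmodType S) n p (phi : {linear 'rV[S]_n -> M})
    (psi : {linear 'rV[S]_p -> M}) : (forall x, exists v, phi v = x) ->
  exists L : 'M[S]_(p, n), forall y, phi (y *m L) = psi y.
Proof.
move=> surj; have /choice[l lE] : forall j, exists v, phi v = psi (delta_mx 0 j).
  by move=> j; exact: surj.
exists (\matrix_j l j) => y; rewrite mulmx_lc linear_lc [RHS]rV_lc.
by congr lc; apply/funext => j /=; rewrite rowK lE.
Qed.

Lemma ker_submod (U V : lmodType S) (f : {linear U -> V}) :
  submod [set x | f x = 0].
Proof.
split=> [|a x y /= fx fy]; first exact: linear0.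
by rewrite linearP fx fy scaler0 addr0.
Qed.

(* Schanuel's lemma: the pullback of phi and psi is generated by d + p elements
   and has residue dimension e + n. *)
Lemma schanuel_leq (M : lmodType S) n p d e (phi : {linear 'rV[S]_n -> M})
    (psi : {linear 'rV[S]_p -> M}) tau sigma :
  (forall x, exists v, phi v = x) -> (forall x, exists v, psi v = x) ->
  @res_coord _ mS _ [set v | phi v = 0] d tau ->
  @res_coord _ mS _ [set v | psi v = 0] e sigma -> (e + n <= d + p)%N.
Proof.
move=> phis psis rt rs.
have [L LE] := linear_lift psi phis; have [L' L'E] := linear_lift phi psis.
have psub := ker_submod psi.
have [x [xK xt]] := res_coord_gens rt.
pose X := \matrix_i x i.
pose g i := - (x i *m L'); pose h j := delta_mx 0 j - row j L *m L'.
have gK i : psi (g i) = 0 by rewrite linearN /= L'E xK oppr0.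
have hK j : psi (h j) = 0 by rewrite linearB /= L'E rowE LE subrr.
(* A pair (v, y) with [phi v = psi y] has residue coordinates [sigma (y - v *m L')] and the residue
   of v. The rows of [T] are those of the generators [(x i, 0)] and [(row j L, delta_mx 0 j)] of the
   pullback. *)
pose T := block_mx (\matrix_i sigma (g i)) (map_mx rho X)
                   (\matrix_j sigma (h j)) (map_mx rho L).
suff : row_full T by rewrite /row_full => /eqP <-; exact: rank_leq_row.
apply: row_full_surj => w.
have [x1 x1E] := residue_mx_surj (rsubmx w).
have [_ surj _] := rs; have [y0 y0K y0E] := surj (lsubmx w).
pose y := y0 + x1 *m L'.
have [c cE] : exists c, x1 - y *m L = lc x c.
  have [_ _ nak] := rt; apply: nak xK _ _ _; first by rewrite xt /row_full mxrank1.
  by rewrite /= linearB /= LE linearD /= y0K add0r L'E subrr.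
exists (row_mx (map_mx rho c) (map_mx rho y)).
rewrite /T mul_row_block -[w in LHS]hsubmxK.
have x1c : x1 = c *m X + y *m L.
  rewrite mulmx_lc [X in lc X](_ : _ = x) -?cE ?subrK //.
  by apply/funext => j; rewrite rowK.
congr row_mx; last by rewrite -x1E -!map_mxM -map_mxD -x1c.
have [lin _ _] := rs.
rewrite -!(res_coord_lc psub rs) // -y0E.
rewrite -[_ + _]/(_ + sigma (lc h y)) -[sigma (lc g c)]scale1r -(rmorph1 rho) -lin.
- congr sigma; rewrite scale1r.
  have -> : lc g c = - (c *m X *m L').
    rewrite -mulmxA -mulmxN mulmx_lc; congr lc; apply/funext => j.
    by rewrite linearN /= row_mul rowK.
  have -> : lc h y = y - y *m L *m L'.
    have -> : y - y *m L *m L' = y *m (1%:M - L *m L').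
      by rewrite mulmxBr mulmx1 mulmxA.
    rewrite mulmx_lc; congr lc; apply/funext => j.
    by rewrite linearB /= row_mul row1.
  rewrite addrCA -opprD -mulmxDl -x1c.
  by rewrite /y addrK.
- by apply: submod_lc.
- by apply: submod_lc.
Qed.

(** With K the kernel of the augmentation, the equality is the dimension count in $0 \to Tor_1 \to
    K/mK \to k^{r_0} \to M/mM \to 0$. *)
Lemma tor_dim_res_coord (M : lmodType S) (F : free_resolution M) :
  (exists tau, @res_coord _ mS M setT (tor_dim mS F 0) tau) /\
  exists d tau, @res_coord _ mS _ [set v | res_aug F v = 0] d tau /\
    (d + tor_dim mS F 0 = tor_dim mS F 1 + res_rank F 0)%N.
Proof.
split.
  apply: (res_coord_presentation (f := res_aug F) (B := res_diff F 0)) => //.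
    by move=> y; split=> // _; exact: res_aug_surj.
  exact: res_exact0.
exists (res_rank F 1 - \rank (res_diff_residue mS F 1))%N.
have [||tau taur] := res_coord_presentation (mS := mS) (P := [set v | res_aug F v = 0])
   (f := mulmxr (res_diff F 0)) (B := res_diff F 1) jac _ _ erefl.
- by move=> y; split=> [/res_exact0[w ->]|[w <-]]; [exists w|apply/res_exact0; exists w].
- by move=> v; exact: res_exact.
exists tau; split=> //; rewrite /tor_dim mxrank_ker.
have r0 : (\rank (res_diff_residue mS F 0) <= res_rank F 0)%N := rank_leq_col _.
(* Consecutive differentials compose to zero, so the subtraction of naturals in [tor_dim mS F 1]
   does not truncate. *)
have : (\rank (res_diff_residue mS F 1) + \rank (res_diff_residue mS F 0)
    <= res_rank F 1)%N.
  apply: mulmx0_rank_max; rewrite -map_mxM.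
  suff -> : res_diff F 1 *m res_diff F 0 = 0 by rewrite map_mx0.
  apply/row_matrixP => i; rewrite row_mul row0; apply/res_exact.
  by exists (delta_mx 0 i); rewrite rowE.
by move: r0; rewrite /res_diff_residue; lia.
Qed.

(** The two Betti numbers may be read off different resolutions [E] and [F]: degree 0 is intrinsic
    by [res_coord_uniq], and Schanuel's lemma in both directions compares [phi] with the
    augmentation of [F]. Some resolution exists, so the default of [xget] never occurs. *)
Lemma betti_kernel (M : lmodType S) n (phi : {linear 'rV[S]_n -> M}) :
  fg_submodules S -> (forall x, exists v, phi v = x) ->
  (exists tau, @res_coord _ mS M setT (betti mS M 0) tau) /\
  exists d tau, @res_coord _ mS _ [set v | phi v = 0] d tau /\
    (d + betti mS M 0 = betti mS M 1 + n)%N.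
Proof.
move=> fg surj; have [F0] := free_resolution_exists fg surj.
have bettiE i : exists F : free_resolution M, betti mS M i = tor_dim mS F i.
  apply: (@xgetPex _ 0%N [set b | exists F : free_resolution M, b = tor_dim mS F i]).
  by exists (tor_dim mS F0 i), F0.
have [E bE] := bettiE 0%N; have [F b1E] := bettiE 1%N.
have [[tE tEr] _] := tor_dim_res_coord E.
have [[tF tFr] [d [tau [taur dE]]]] := tor_dim_res_coord F.
have EF := res_coord_uniq (conj I (fun _ _ _ _ _ => I)) tEr tFr.
split; first by rewrite bE; exists tE.
have [r' [B BE]] := fg_kernel phi fg.
have [p [B' B'E]] := fg_kernel (mulmxr B) fg.
have [||sigma sr] := res_coord_presentation (mS := mS) (P := [set v | phi v = 0])
   (f := mulmxr B) (B := B') jac _ _ erefl.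
- by move=> y; split=> [/BE[w ->]|[w <-]]; [exists w|apply/BE; exists w].
- exact: B'E.
exists (r' - \rank (map_mx rho B'))%N, sigma; split=> //.
have le1 := schanuel_leq surj (@res_aug_surj _ _ F) sr taur.
have le2 := schanuel_leq (@res_aug_surj _ _ F) surj taur sr.
rewrite bE b1E EF; lia.
Qed.

End Betti.

(** * Counting matrices of full rank *)

Section RankCount.
Variable F : finFieldType.

Lemma card_rV_submx N a (A : 'M[F]_(a, N)) :
  #|[set b : 'rV[F]_N | (b <= A)%MS]%SET| = (#|F| ^ \rank A)%N.
Proof.
pose f (c : 'rV[F]_(\rank A)) := c *m row_base A.
have -> : [set b : 'rV[F]_N | (b <= A)%MS]%SET = [set f c | c in predT]%SET.
  apply/setP => b; rewrite inE; apply/idP/imsetP => [|[c _ ->]].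
    by rewrite -(eq_row_base A) => /submxP[c ->]; exists c.
  by apply: submx_trans (submxMl _ _) _; rewrite eq_row_base.
rewrite card_imset; last exact/row_free_inj/row_base_free.
by rewrite card_mx mul1n.
Qed.

(** Induction on the number of rows: the first row must avoid the row space of A, which leaves $q^N
    - q^{rank A}$ choices, and is then absorbed into A. *)
Lemma card_rank_extension e N a (A : 'M[F]_(a, N)) :
  #|[set B : 'M[F]_(e, N) | \rank (A + B)%MS == (\rank A + e)%N]%SET| =
    (\prod_(i < e) (#|F| ^ N - #|F| ^ (\rank A + i)))%N.
Proof.
elim: e a A => [|e IH] a A.
  rewrite big_ord0 -(cards1 (0 : 'M[F]_(0, N))); apply: eq_card => B.
  by rewrite !inE [B]flatmx0 addsmx0 addn0 !eqxx.
rewrite -sum1_card (eq_bigl (fun B : 'M[F]_(e.+1, N) =>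
   \rank (A + B)%MS == (\rank A + e.+1)%N)); last by move=> B; rewrite inE.
rewrite (reindex (fun p : 'rV[F]_N * 'M[F]_(e, N) => (col_mx p.1 p.2 : 'M[F]_(1 + e, N)))) /=;
  last first.
  exists (fun B : 'M[F]_(1 + e, N) => (usubmx B, dsubmx B)) => [[b B]|B] _ /=.
    by rewrite col_mxKu col_mxKd.
  by rewrite vsubmxK.
have rankE (b : 'rV[F]_N) (B : 'M[F]_(e, N)) :
    \rank (A + col_mx b B)%MS = \rank ((A + b)%MS + B)%MS.
  have h := adds_eqmx (eqmx_refl A) (eqmx_sym (addsmxE b B)).
  by rewrite -addsmxA h.
have rankb (b : 'rV[F]_N) : \rank (A + b)%MS = (\rank A + ~~ (b <= A)%MS)%N.
  case: (boolP (b <= A)%MS) => bA /=; first by rewrite addn0 (addsmx_idPl bA).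
  apply/eqP; rewrite eqn_leq; apply/andP; split.
    by apply: leq_trans (mxrank_adds_leqif A b).1 _; rewrite leq_add2l rank_leq_row.
  rewrite addn1; have [sAb eqAb] := mxrank_leqif_sup (addsmxSl A b).
  rewrite ltn_neqAle sAb andbT eqAb; apply: contra bA.
  exact: submx_trans (addsmxSr A b).
rewrite -(pair_big_dep predT (fun b B => \rank (A + col_mx b B)%MS == (\rank A + e.+1)%N)
   (fun _ _ => 1%N)) /=.
rewrite (bigID (fun b => (b <= A)%MS)) /= [X in (X + _)%N]big1 ?add0n; last first.
  move=> b bA; rewrite big_pred0 // => B; rewrite rankE; apply/negbTE.
  rewrite neq_ltn; apply/orP; left; apply: leq_ltn_trans (mxrank_adds_leqif _ _).1 _.
  by rewrite rankb bA addn0 addnS ltnS leq_add2l rank_leq_row.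
rewrite (eq_bigr (fun=> \prod_(i < e) (#|F| ^ N - #|F| ^ (\rank A + i.+1)))%N); last first.
  move=> b bA; have := IH _ (A + b)%MS; rewrite -sum1_card.
  rewrite rankb bA addn1 => E.
  under [RHS]eq_bigr do rewrite addnS -addSn.
  rewrite -E; apply: eq_bigl => B.
  by rewrite inE rankE addSnnS.
rewrite sum_nat_const big_ord_recl addn0; congr (_ * _)%N.
have cN : (#|F| ^ N)%N = #|[set: 'rV[F]_N]%SET| by rewrite cardsT card_mx mul1n.
rewrite -(card_rV_submx A) cN -cardsDS ?finset.subsetT //.
by apply: eq_card => b; rewrite !inE andbT.
Qed.

End RankCount.

(** A residue field is known to be finite only as a set; enumerating it supplies the structure under
    which spaces of matrices have a cardinal. *)
Lemma finite_fieldW (P : fieldType -> Prop) :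
  (forall F : finFieldType, P F) ->
  forall k : fieldType, finite_set [set: k] -> P k.
Proof.
move=> PF [T c]; destruct c; set k : fieldType := (X in P X) => kfin.
have [s [us sE _]] := ncardE kfin.
have sall (x : k) : x \in s by apply/sE.
pose pk (x : k) := index x s; pose upk i : option k := onth s i.
have pkK : pcancel pk upk.
  by move=> x; rewrite /upk /pk onthE (nth_map x) ?index_mem // nth_index.
have enumP : Finite.axiom s by move=> x; rewrite count_uniq_mem // sall.
pose F : finFieldType := HB.pack k
  (Choice_isCountable.Build k pkK) (fintype.isFinite.Build k enumP).
exact: (PF F).
Qed.

Lemma ncard_full_extension (k : fieldType) N e d1 (A : 'M[k]_(N, d1)) :
  finite_set [set: k] -> \rank A = d1 ->
  ncard [set B : 'M[k]_(N, e) | row_full (row_mx B A)] =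
    (\prod_(i < e) (ncard [set: k] ^ N - ncard [set: k] ^ (d1 + i)))%N.
Proof.
move=> kfin; move: k kfin A; apply: finite_fieldW => F A rA.
have -> : ncard [set: F] = #|F|.
  rewrite -ncard_fin; congr ncard; by apply/seteqP; split.
have rAt : \rank A^T = d1 by rewrite mxrank_tr.
rewrite -[in RHS]rAt -card_rank_extension -ncard_fin.
rewrite -[LHS](@ncard_image _ _ (@trmx F N e)); last 2 first.
- exact: finite_finset.
- by move=> B C _ _; exact: trmx_inj.
congr ncard; apply/seteqP.
have rk (B : 'M[F]_(N, e)) : row_full (row_mx B A) =
    (\rank (A^T + B^T)%MS == (\rank A^T + e)%N).
  by rewrite /row_full -mxrank_tr tr_row_mx addsmxC addsmxE rAt [(d1 + e)%N]addnC.
split=> [_ [B /= fB <-]|B /=]; first by rewrite inE -rk.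
by rewrite inE => fB; exists B^T; rewrite ?trmxK //= rk trmxK.
Qed.

(** Gaussian elimination writes W as an invertible matrix times [pid_mx] times [row_ebase W]; the
    inverse of the last factor is the change of basis. *)
Lemma adapted_basis (k : fieldType) r e d1 (W : 'M[k]_(r, e + d1)) :
  \rank W = e -> exists Q : 'M[k]_(e + d1), Q \in unitmx /\
    forall v : 'rV[k]_(e + d1), (v <= W)%MS <-> rsubmx (v *m Q) = 0.
Proof.
move=> rW; pose U := row_ebase W; exists (invmx U).
have Uu : U \in unitmx := row_ebase_unit W.
split; first by rewrite unitmx_inv.
pose E : 'M[k]_(e, e + d1) := row_mx 1%:M 0.
have ER p (v : 'M[k]_(p, e + d1)) : (v <= E)%MS <-> rsubmx v = 0.
  split=> [/submxP[w ->]|v0]; first by rewrite mul_mx_row mulmx0 row_mxKr.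
  apply/submxP; exists (lsubmx v).
  by rewrite mul_mx_row mulmx1 mulmx0 -v0 hsubmxK.
have WE : (W *m invmx U <= E)%MS.
  apply/ER; rewrite -[W](mulmx_ebase W) mulmxK // rW.
  apply/matrixP => i j; rewrite !mxE big1 // => l _.
  rewrite !mxE /=; case: eqP => [->|_]; last by rewrite mulr0.
  by rewrite ltnNge leq_addr /= mulr0.
have EW : (E <= W *m invmx U)%MS.
  have rWU : \rank (W *m invmx U) = e.
    by rewrite mxrankMfree // row_free_unit unitmx_inv.
  by rewrite -(mxrank_leqif_sup WE).2 eqn_leq mxrankS //= rWU rank_leq_row.
move=> v; rewrite -ER; split=> vW.
  by apply: submx_trans WE; apply: submxMr.
have := submxMr U (submx_trans vW EW).
by rewrite !mulmxKV.
Qed.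

(** Divided by $q^N$, a factor becomes $1 - q^{-(N - d_1 - i)}$; as i runs below e, the exponent
    descends from $N - d_1$ to $N - d_1 - e + 1$. *)
Lemma prod_extension_ratio (K : numFieldType) (q N d1 e : nat) : (0 < q)%N ->
  (d1 + e <= N)%N ->
  (\prod_(i < e) (q ^ N - q ^ (d1 + i)))%N%:R / ((q ^ (N * e))%N%:R : K) =
  \prod_((N - (d1 + e)).+1 <= i < (N - d1).+1) (1 - q%:R ^- i).
Proof.
move=> q0; elim: e => [|e IH] leN.
  by rewrite big_ord0 muln0 expn0 divr1 addn0 big_geq.
have qK : (q%:R : K) != 0 by rewrite pnatr_eq0 -lt0n.
rewrite big_ord_recr /= mulnS [(N + N * e)%N]addnC [(q ^ (N * e + N))%N]expnD !natrM.
rewrite [RHS]big_ltn ?ltnS; last by lia.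
have -> : (N - (d1 + e.+1)).+1 = (N - (d1 + e))%N by lia.
rewrite -IH; last by lia.
rewrite natrB; last by rewrite leq_pexp2l //; lia.
rewrite !natrX.
have -> : q%:R ^- (N - (d1 + e)) = (q%:R ^+ (d1 + e)) / (q%:R ^+ N) :> K.
  have <- : q%:R ^+ (d1 + e) * q%:R ^+ (N - (d1 + e)) = q%:R ^+ N :> K.
    by rewrite -exprD subnKC //; lia.
  by rewrite invfM mulrA divff ?mul1r // expf_neq0.
have h1 : q%:R ^+ N != 0 :> K by rewrite expf_neq0.
have h2 : q%:R ^+ (N * e) != 0 :> K by rewrite expf_neq0.
by field; rewrite h1 h2.
Qed.

(** N vectors cannot span a space of dimension d1 + e > N; in the formula, the factor of index N -
    d1 is zero. *)
Lemma prod_extension_eq0 (q N d1 e : nat) : (d1 <= N)%N -> (N < d1 + e)%N ->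
  (\prod_(i < e) (q ^ N - q ^ (d1 + i)))%N = 0%N.
Proof.
move=> dN Ne; have iN : (N - d1 < e)%N by lia.
by rewrite (bigD1 (Ordinal iN)) //= subnKC // subnn mul0n.
Qed.

(** * Powers of the maximal ideal *)

Section IdealPowers.
Variables (R : comNzRingType) (m : idealr R).
Local Notation mpow := (ideal_pow [set` m]).

Lemma ideal_powD k x y : mpow k x -> mpow k y -> mpow k (x + y).
Proof.
case: k => [//|k] [l1 [y1 [z1 [y1I z1J ->]]]] [l2 [y2 [z2 [y2I z2J ->]]]].
exists (l1 + l2)%N.
exists (fun j => match fintype.split j with inl j1 => y1 j1 | inr j2 => y2 j2 end).
exists (fun j => match fintype.split j with inl j1 => z1 j1 | inr j2 => z2 j2 end).
split=> [j|j|]; [by case: (fintype.split j)|by case: (fintype.split j)|].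
rewrite big_split_ord /=; congr (_ + _); apply: eq_bigr => j _.
  by rewrite (unsplitK (inl j)).
by rewrite (unsplitK (inr j)).
Qed.

Lemma ideal_powX k x : x \in m -> mpow k (x ^+ k).
Proof.
move=> xm; elim: k => [//|k IH].
exists 1%N, (fun=> x), (fun=> x ^+ k); split=> //.
by rewrite big_ord1 exprS.
Qed.

End IdealPowers.

Section Completeness.
Variables (R : comNzRingType) (m : maxIdealr R).
Local Notation mpow := (ideal_pow [set` m]).

(* The geometric series inverts 1 - x. *)
Lemma complete_in_jacobson : adically_complete m -> in_jacobson m.
Proof.
move=> compl x xm.
have [k|l [lE _]] := compl (fun k => \sum_(i < k) x ^+ i).
  by rewrite big_ord_recr /= addrAC subrr add0r; apply: ideal_powX.
exists l.
(* Limits are unique, and both 1 and [l * (1 - x)] are limits of the constant sequence 1. *)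
have [k|l' [_ l'E]] := compl (fun=> 1); first by rewrite subrr; exact: ideal_pow0.
have l1 : l' = 1 by apply: l'E => k; rewrite subrr; exact: ideal_pow0.
rewrite -[RHS]l1; apply/esym/l'E => k.
have -> : 1 - l * (1 - x) = (1 - x) * ((\sum_(i < k) x ^+ i) - l) + x ^+ k.
  have : 1 - x ^+ k = (1 - x) * \sum_(i < k) x ^+ i.
    rewrite -[1 in LHS](expr1n R k) subrXX; congr (_ * _); apply: eq_bigr => i _.
    by rewrite expr1n mul1r.
  by move=> e; rewrite -[x ^+ k in RHS](subKr 1) e; ring.
by apply: ideal_powD; [exact/ideal_powMl/lE|exact: ideal_powX].
Qed.

(* If y is in m and v <> 0, the orbit R(yv) is strictly smaller than Rv: v = b y v
   would force v = 0 as 1 - b y is a unit. *)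
Lemma ideal_pow_annihilates (V : lmodType R) :
  in_jacobson m -> finite_set [set: V] ->
  exists L, forall x (v : V), mpow L x -> x *: v = 0.
Proof.
move=> jac Vfin.
pose orb (v : V) : set V := [set y | exists a, y = a *: v].
have orbfin v : finite_set (orb v) by apply: sub_finite_set Vfin.
have orbv v : orb v v by exists 1; rewrite scale1r.
suff H c v x : (ncard (orb v) <= c)%N -> mpow c x -> x *: v = 0.
  exists (ncard [set: V]) => x v; apply: H; apply: fsubset_leq_card.
  by rewrite -fset_set_sub.
elim: c v x => [|c IH] v x.
  by rewrite leqNgt (ncard_gt0 (orbfin v) (orbv v)).
move=> vc [l [y [z [ym zc ->]]]].
rewrite scaler_suml big1 // => j _; rewrite mulrC -scalerA.
have [->|v0] := eqVneq v 0; first by rewrite !scaler0.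
apply: IH (zc j); rewrite -ltnS; apply: leq_trans vc.
apply: (ncard_ltn (orbfin v) _ (orbv v)) => [_ [b ->]|[b vE]].
  by exists (b * y j); rewrite scalerA.
have [|u uE] := jac (b * y j); first exact/idealMr/ym.
move: v0; rewrite -[v]scale1r -uE -scalerA scalerBl scale1r -scalerA -vE subrr.
by rewrite scaler0 eqxx.
Qed.

End Completeness.

(** * Haar measure of unions of cosets *)

Section Haar.
Variables (K : realType) (R : comNzRingType) (m : idealr R) (p q : nat).
Variable mu : probability (borel_mx m p q) K.
Hypothesis haar : haar_probability mu.
Local Notation mpow := (ideal_pow [set` m]).
Implicit Types A B C : set 'M[R]_(p, q).

Definition level_invariant L A : Prop :=
  forall X Y : 'M[R]_(p, q), A X -> (forall i j, mpow L (Y i j)) -> A (X + Y).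

Definition clopen_mx A : Prop := exists L, level_invariant L A.

Lemma clopen_mx_measurable A : clopen_mx A -> measurable (A : set (borel_mx m p q)).
Proof.
move=> [L AL]; apply: sub_sigma_algebra.
suff : @open 'M[adic m]_(p, q) A by [].
rewrite openE => X AX.
exists (fun i j => [set y : adic m | mpow L ((y : R) - X i j)]); last first.
  move=> Y /= XY; rewrite -[Y](subrK X) addrC; apply: AL => // i j.
  by rewrite !mxE; exact: XY.
move=> i j; apply: open_nbhs_nbhs; split; last by rewrite /= subrr; exact: ideal_pow0.
move=> y /= yX; exists L => z zy.
by rewrite /= -[z](subrK y) -addrA; apply: ideal_powD.
Qed.

Definition pr A : K := fine (mu A).

Lemma pr_translate A B (Y : 'M[R]_(p, q)) : clopen_mx A ->
  (forall X, A X -> B (Y + X)) -> (forall X, B X -> A (X - Y)) -> pr A = pr B.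
Proof.
move=> /clopen_mx_measurable mA AB BA; rewrite /pr -(haar Y mA).
congr (fine (mu _)); apply/seteqP; split=> [_ [X AX <-]|X BX]; first exact: AB.
by exists (X - Y); [exact: BA|rewrite addrC subrK].
Qed.

(** The single tool for comparing probabilities: a finite partition by the values of [f] into
    equiprobable parts, most often translates of one another. *)
Lemma pr_fibers (T : choiceType) (f : 'M[R]_(p, q) -> T) C (S : set T) (c : K) :
  finite_set S -> (forall t, S t -> clopen_mx (C `&` f @^-1` [set t])) ->
  (forall t, S t -> pr (C `&` f @^-1` [set t]) = c) ->
  pr (C `&` f @^-1` S) = (ncard S)%:R * c.
Proof.
move=> Sfin mS cS; rewrite /pr.
have -> : C `&` f @^-1` S = \bigcup_(t in S) (C `&` f @^-1` [set t]).
  apply/seteqP; split=> [X [CX SX]|X [t St [CX /= ft]]]; first by exists (f X).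
  by split=> //; rewrite /= ft.
rewrite measure_fin_bigcup //=; last 2 first.
- by move=> s t _ _ [X [[_ /= <-] [_ /= <-]]].
- by move=> t St; apply: clopen_mx_measurable; exact: mS.
rewrite fsbig_finite // big_seq (eq_bigr (fun=> c%:E)); last first.
  move=> t; rewrite in_fset_set // inE => St.
  rewrite -(cS t St) /pr fineK //; apply: fin_num_measure.
  by apply: clopen_mx_measurable; exact: mS.
by rewrite -big_seq sumEFin /= big_const_seq count_predT iter_addr_0 mulr_natl.
Qed.

End Haar.

(** * Cokernels and reduction modulo an ideal *)

Section QuotientMap.
Variables (R : comNzRingType) (V : lmodType R) (N : submodClosed V).

Definition qpi (x : V) : quotmod N := \pi_(quotmod N) x.

Lemma qpi_is_linear : linear qpi.
Proof.
move=> a x y; rewrite /qpi quotmod_piD; congr (_ + _).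
by rewrite -(quotmod_piZ N a x).
Qed.

HB.instance Definition _ :=
  GRing.isLinear.Build R V (quotmod N) *:%R qpi qpi_is_linear.

Lemma qpi_eq0 x : qpi x = 0 <-> x \in N.
Proof.
rewrite -(linear0 qpi) /qpi; split=> [/quotmod_eqP|xN]; first by rewrite subr0.
by apply/quotmod_eqP; rewrite subr0.
Qed.

Lemma qpi_surj y : exists x, qpi x = y.
Proof. by have [x ->] := quotmod_surj y; exists x. Qed.

End QuotientMap.

Lemma inj_surj_bijective (T U : choiceType) (f : T -> U) :
  injective f -> (forall y, exists x, f x = y) -> bijective f.
Proof.
move=> inj /choice[g gE]; exists g => // x; exact/inj/gE.
Qed.

Lemma finite_injective_surj (T : choiceType) (f : T -> T) :
  finite_set [set: T] -> injective f -> forall y, exists x, f x = y.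
Proof.
move=> Tfin inj y; apply: contrapT => ny.
have : (ncard (f @` [set: T]) < ncard [set: T])%N.
  by apply: (@ncard_ltn _ _ _ y) => // -[x _ xy]; apply: ny; exists x.
by rewrite ncard_image ?ltnn // => a b _ _; exact: inj.
Qed.

Section Generators.
Variables (R : comNzRingType) (V : lmodType R) (n : nat).
Implicit Types g e : 'I_n -> V.

Lemma lc_comp_linear (U : lmodType R) (f : V -> U) g v :
  linear f -> f (lc g v) = lc (f \o g) v.
Proof.
move=> lf; pose F : {linear V -> U} := HB.pack f (GRing.isLinear.Build R V U *:%R f lf).
exact: (linear_lc F).
Qed.

(** [g] factors through [e]; equality of kernels makes the factor injective and finiteness makes it
    onto, so surjectivity of [g] comes out instead of being assumed. *)
Lemma ker_eq_aut e g : finite_set [set: V] ->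
  (forall y, exists v, lc e v = y) -> (forall v, lc e v = 0 <-> lc g v = 0) ->
  exists2 f, lmod_aut V f & forall i, f (e i) = g i.
Proof.
move=> Vfin /choice[s sE] keq; pose f y := lc g (s y).
have fE v : f (lc e v) = lc g v.
  apply/eqP; rewrite -subr_eq0 -linearB; apply/eqP/keq.
  by rewrite linearB /= sE subrr.
have flin : linear f.
  move=> a x y; rewrite -(sE x) -(sE y) -linearP !fE linearP.
  by [].
have finj : injective f.
  move=> x y; rewrite -(sE x) -(sE y) !fE => /eqP.
  rewrite -subr_eq0 -linearB => /eqP/keq; rewrite linearB => /eqP.
  by rewrite subr_eq0 => /eqP.
exists f; last by move=> i; rewrite -(lc_delta e) fE lc_delta.
split=> //; apply: inj_surj_bijective => //.
exact: finite_injective_surj.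
Qed.

(** The first isomorphism theorem, and the passage from the columns used by [cok] to the row vectors
    used by [lc]; hence the transposes. *)
Lemma cok_iso_generators N (X : 'M[R]_(n, N)) :
  lmod_iso (cok X) V <-> exists g, (forall y, exists v, lc g v = y) /\
    forall v, lc g v = 0 <-> exists w, v = w *m X^T.
Proof.
have spanE (v : 'rV[R]_n) : v^T \in colspan X <-> exists w, v = w *m X^T.
  split=> [/asboolP[w vE]|[w ->]].
    by exists w^T; rewrite -trmx_mul -vE trmxK.
  by apply/asboolP; exists w^T; rewrite trmx_mul trmxK.
split=> [[f [h fK hK]]|[g [gsurj gker]]].
  pose g i := f (@qpi _ _ (colspan X) (delta_mx i 0)).
  have gE v : lc g v = f (@qpi _ _ (colspan X) v^T).
    pose F : {linear 'rV[R]_n -> V} := f \o qpi (colspan X) \o @trmx R 1 n.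
    rewrite -[RHS]/(F v) (rV_lc F).
    by congr lc; apply/funext => i /=; rewrite trmx_delta.
  exists g; split=> [y|v].
    have [x xE] := qpi_surj (h y); exists x^T.
    by rewrite gE trmxK xE hK.
  rewrite gE -spanE -qpi_eq0; split=> [e|->]; last exact: linear0.
  by rewrite -[LHS]fK e -(linear0 f) fK.
pose f (x : cok X) := lc g (repr x)^T.
have fE (v : 'cV_n) : f (qpi _ v) = lc g v^T.
  apply/eqP; rewrite -subr_eq0 -linearB; apply/eqP/gker/spanE.
  rewrite -linearB trmxK; apply/quotmod_eqP.
  by rewrite reprK.
have flin : linear f.
  move=> a x y; have [v <-] := qpi_surj x; have [w <-] := qpi_surj y.
  by rewrite -linearP !fE linearP linearP.
pose F : {linear cok X -> V} := HB.pack f (GRing.isLinear.Build R (cok X) V *:%R f flin).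
exists F.
apply: inj_surj_bijective => [x y|y] /=.
  have [v <-] := qpi_surj x; have [w <-] := qpi_surj y; rewrite !fE => /eqP.
  rewrite -subr_eq0 -linearB => /eqP/gker/spanE; rewrite -linearB trmxK.
  by move/quotmod_eqP.
by have [v vE] := gsurj y; exists (qpi _ v^T); rewrite fE trmxK.
Qed.

End Generators.

Lemma res_coord_mulmx (S : comNzRingType) (mS : maxIdealr S) (V : lmodType S)
    (P : set V) d (tau : V -> 'rV[residue_field mS]_d) (Q : 'M[_]_d) :
  res_coord P tau -> Q \in unitmx -> res_coord P (fun x => tau x *m Q).
Proof.
move=> [lin surj nak] Qu; split=> [b x y Px Py|w|r x Px full].
- by rewrite lin // mulmxDl scalemxAl.
- by have [x Px tx] := surj (w *m invmx Q); exists x; rewrite // tx mulmxKV.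
apply: nak Px _; move: full.
have -> : \matrix_i (tau (x i) *m Q) = (\matrix_i tau (x i)) *m Q.
  by apply/row_matrixP => i; rewrite row_mul !rowK.
by rewrite /row_full mxrankMfree // row_free_unit.
Qed.

Section Reduction.
Variables (R : comNzRingType) (m : maxIdealr R) (a : idealr R).
Hypothesis am : {subset a <= m}.
Local Notation A := {ideal_quot a}.
Local Notation pa := \pi_A.

Lemma pi_ideal_eq0 x : pa x = 0 <-> x \in a.
Proof.
rewrite -(rmorph0 pa); split=> [/eqP|xa]; first by rewrite -Quotient.idealrBE subr0.
by apply/eqP; rewrite -Quotient.idealrBE subr0.
Qed.

Lemma map_pi_eq0 p q (X : 'M[R]_(p, q)) :
  map_mx pa X = 0 <-> forall i j, X i j \in a.
Proof.
split=> [/matrixP X0 i j|X0]; first by apply/pi_ideal_eq0; have := X0 i j; rewrite !mxE.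
by apply/matrixP => i j; rewrite !mxE; apply/pi_ideal_eq0.
Qed.

Lemma map_pi_surj p q (B : 'M[A]_(p, q)) : exists X, map_mx pa X = B.
Proof.
exists (map_mx (fun x : A => repr x) B); apply/matrixP => i j; rewrite !mxE.
exact: reprK.
Qed.

Lemma quot_in_jacobson : in_jacobson m -> in_jacobson (quot_maxideal am).
Proof.
move=> jac _ /asboolP[y ym ->]; have [z zy] := jac y ym.
by exists (pa z); rewrite -(rmorph1 pa) -rmorphB -rmorphM zy.
Qed.

Variable G : lmodType R.
Local Notation aG := (idealmod a G).
Local Notation Ga := (redmod a G).

Lemma idealmod_lc n (g : 'I_n -> G) v : map_mx pa v = 0 -> lc g v \in aG.
Proof.
move=> /map_pi_eq0 v0; apply/asboolP; exists n, (fun i => v 0 i), g.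
by split=> // i; exact: v0.
Qed.

Lemma idealmod_lcP n (g : 'I_n -> G) y : (forall y, exists v, lc g v = y) ->
  y \in aG -> exists2 v, map_mx pa v = 0 & lc g v = y.
Proof.
move=> /choice[s sE] /asboolP[l [c [x [ca ->]]]].
exists (\sum_j c j *: s (x j)).
  apply/map_pi_eq0 => i j; rewrite summxE; apply: rpred_sum => t _.
  by rewrite mxE mulrC; apply: idealMr.
by rewrite linear_sum; apply: eq_bigr => j _; rewrite linearZ /= sE.
Qed.

(** The target is a module over R/a, so this is not a linear map for the library; [rpi_lc] records
    how scalars are reduced. *)
Definition rpi (x : G) : Ga := qpi aG x.

Lemma rpi_eq0 x : rpi x = 0 <-> x \in aG.
Proof. exact: (qpi_eq0 aG). Qed.

Lemma rpi_surj y : exists x, rpi x = y.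
Proof. exact: (qpi_surj (N := aG)). Qed.

Lemma rpiB x y : rpi (x - y) = rpi x - rpi y.
Proof. exact: (linearB (qpi aG)). Qed.

Lemma rpi_lc n (g : 'I_n -> G) v : rpi (lc g v) = lc (rpi \o g) (map_mx pa v).
Proof.
rewrite [LHS](linear_sum (qpi aG)); apply: eq_bigr => i _.
rewrite [LHS](linearZ_LR (qpi aG)) mxE /=.
exact/esym/redmod_piZ.
Qed.

Local Notation k := (residue_field m).
Local Notation b0 := (betti m G 0).
Local Notation b1 := (betti m G 1).
Local Notation b1' := (betti (quot_maxideal am) (redmod a G) 1).

Hypothesis jac : in_jacobson m.
Hypothesis fg : fg_submodules R.
Hypothesis Ra_finite : finite_set [set: A].
Hypothesis k_finite : finite_set [set: k].

Lemma res_coord_ideal (V : lmodType R) (P : set V) d (tau : V -> 'rV[k]_d) x y :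
  submod P -> res_coord P tau -> x \in m -> P y -> P (x *: y) /\ tau (x *: y) = 0.
Proof.
move=> Psub rt xm Py; have [P0 PS] := Psub; have [lin _ _] := rt.
rewrite -[x *: y]addr0; split; first exact: PS.
rewrite lin // (res_coord0 Psub rt).
by move: xm; rewrite -residue_eq0 => /eqP ->; rewrite scale0r addr0.
Qed.

Lemma submod_res_coord0 (V : lmodType R) (P : set V) d (tau : V -> 'rV[k]_d) :
  submod P -> res_coord P tau -> submod [set x | P x /\ tau x = 0].
Proof.
move=> Psub rt; have [P0 PS] := Psub; have [lin _ _] := rt.
split=> [|b x y [Px tx] [Py ty]]; first by split=> //; exact: res_coord0 rt.
by split; [exact: PS|rewrite lin // tx ty scaler0 addr0].
Qed.

Lemma res_coord_idealmod d (tau : G -> 'rV[k]_d) z :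
  res_coord setT tau -> z \in aG -> tau z = 0.
Proof.
move=> tr /asboolP[l [b [x [ba ->]]]]; have sub : submod [set: G] by [].
have [|_ ->] // := submod_sum (F := fun j => b j *: x j) (submod_res_coord0 sub tr).
by move=> j; apply: (res_coord_ideal sub tr) => //; exact: am.
Qed.

(** As aG lies in mG, generators of G modulo mG and of G/aG correspond. The residue fields are
    different types, so each inequality carries a minimal system across. *)
Lemma betti0_redmod n (g : 'I_n -> G) : (forall y, exists v, lc g v = y) ->
  betti (quot_maxideal am) Ga 0 = b0.
Proof.
move=> gs.
have gas (y : Ga) : exists v, lc (rpi \o g) v = y.
  have [x <-] := rpi_surj y; have [v <-] := gs x.
  by exists (map_mx pa v); rewrite rpi_lc.
have subT (S : comNzRingType) (V : lmodType S) : submod [set: V] by [].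
have [[t tr] _] := betti_kernel jac fg gs.
have [[t' tr'] _] := betti_kernel (quot_in_jacobson jac) (fg_submodules_finite Ra_finite) gas.
apply/eqP; rewrite eqn_leq; apply/andP; split.
  have [x [_ xt]] := res_coord_gens tr.
  apply: (res_coord_leq (subT _ _) tr' (x := rpi \o x)) => // y _.
  have [z <-] := rpi_surj y; have [_ _ nak] := tr.
  have [//||//|c ->] := nak _ x _ _ z; first by rewrite xt /row_full mxrank1.
  by exists (map_mx pa c); rewrite rpi_lc.
have [x' [_ xt']] := res_coord_gens tr'.
have /choice[x xE] : forall i, exists x, rpi x = x' i by move=> i; exact: rpi_surj.
apply: (res_coord_leq (subT _ _) tr (x := x)) => // y _.
have [_ _ nak] := tr'.
have [//||//|c' yE] := nak _ x' _ _ (rpi y) => //; first by rewrite xt' /row_full mxrank1.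
have [c cE] := map_pi_surj c'; exists c.
have : y - lc x c \in aG.
  apply/rpi_eq0; rewrite rpiB yE rpi_lc cE; apply/eqP; rewrite subr_eq0; apply/eqP.
  by congr lc; apply/funext => i /=; rewrite xE.
have [lin _ _] := tr; move=> /(res_coord_idealmod tr) yz.
by rewrite -[y](subrK (lc x c)) -[y - _]scale1r lin // yz scaler0 add0r.
Qed.

Lemma map_pi_lc r n (x : 'I_r -> 'rV[R]_n) c :
  map_mx pa (lc x c) = lc (fun i => map_mx pa (x i)) (map_mx pa c).
Proof.
apply/rowP => j; rewrite mxE !summxE rmorph_sum; apply: eq_bigr => i _.
by rewrite !mxE rmorphM.
Qed.

(** A lift of [v'] is sent by g into aG, which is the image of $a^n$; subtracting a vector of $a^n$
    brings it into the kernel. *)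
Lemma redmod_ker_lift n (g : 'I_n -> G) v' : (forall y, exists v, lc g v = y) ->
  lc (rpi \o g) v' = 0 -> exists v, lc g v = 0 /\ map_mx pa v = v'.
Proof.
move=> gs; have [v <-] := map_pi_surj v'; rewrite -rpi_lc => /rpi_eq0.
move=> /(idealmod_lcP gs)[z z0 zv]; exists (v - z).
by rewrite linearB /= zv subrr map_mxB z0 subr0.
Qed.

(* Coordinates on K / mK, K the kernel of g, in which the image W of K \cap a^n is
   the vanishing locus of the last d1 of them. *)
Lemma adapted_coordinates n (g : 'I_n -> G) : (forall y, exists v, lc g v = y) ->
  exists e d1 (tau : 'rV[R]_n -> 'rV[k]_(e + d1)),
  [/\ res_coord [set v | lc g v = 0] tau, (e + d1 + b0 = b1 + n)%N,
      (d1 + b0 = b1' + n)%N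
    & forall w, rsubmx w = 0 <->
        exists z, [/\ lc g z = 0, map_mx pa z = 0 & tau z = w]].
Proof.
move=> gs; have [_ [d [tau0 [tr0 dE]]]] := betti_kernel jac fg gs.
have gbs (y : Ga) : exists v, lc (rpi \o g) v = y.
  have [x <-] := rpi_surj y; have [v <-] := gs x.
  by exists (map_mx pa v); rewrite rpi_lc.
have [_ [d' [tau' [tr' dE']]]] :=
  betti_kernel (quot_in_jacobson jac) (fg_submodules_finite Ra_finite) gbs.
move: dE'; rewrite (betti0_redmod gs) => dE'.
have Ksub := ker_submod (lc g); have Ksub' := ker_submod (lc (rpi \o g)).
have [|r [W WE]] := fg_submodules_finite k_finite
   (P := [set w | exists z, [/\ lc g z = 0, map_mx pa z = 0 & tau0 z = w]]).
  split=> [|b _ _ [z1 [z1K z1a <-]] [z2 [z2K z2a <-]]].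
    by exists 0; rewrite linear0 map_mx0 (res_coord0 Ksub tr0).
  have [c <-] := residue_surj b; have [lin _ _] := tr0.
  exists (c *: z1 + z2); rewrite linearP /= z1K z2K scaler0 addr0 lin //.
  by rewrite map_mxD map_mxZ z1a z2a scaler0 addr0.
pose e : nat := \rank W; have rW : \rank W = e by [].
have [d1 de] : exists d1, d = (e + d1)%N.
  by exists (d - e)%N; rewrite subnKC // rank_leq_col.
clearbody e; subst d.
have [Q [Qu QE]] := adapted_basis rW.
pose tau x := tau0 x *m Q.
have tr : res_coord [set v | lc g v = 0] tau := res_coord_mulmx tr0 Qu.
have Wp (w : 'rV[k]_(e + d1)) : rsubmx w = 0 <-> exists z, [/\ lc g z = 0, map_mx pa z = 0 & tau z = w].
  rewrite -{1}(mulmxKV Qu w) -QE; split.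
    move=> /submxP/WE[z [zK za tz]]; exists z; split=> //.
    by rewrite /tau tz mulmxKV.
  move=> [z [zK za <-]]; rewrite /tau mulmxK //.
  by apply/submxP/WE; exists z.
exists e, d1, tau; split=> //.
(* The kernel K' of the reduced map is the image of K, so both numbers are the least number of
   generators of $K / (K \cap a^n)$. *)
suff -> : d1 = d' by [].
have [lin surj nak] := tr.
apply/eqP; rewrite eqn_leq; apply/andP; split.
  have [x' [Kx' xt']] := res_coord_gens tr'.
  have /choice[x xE] : forall i, exists x, lc g x = 0 /\ map_mx pa x = x' i.
    by move=> i; apply: redmod_ker_lift; [exact: gs|exact: Kx'].

  pose B := \matrix_i rsubmx (tau (x i)).
  suff : row_full B by rewrite /row_full => /eqP <-; exact: rank_leq_row.
  apply: row_full_surj => w; have [y Ky ty] := surj (row_mx 0 w).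
  have [_ _ nak'] := tr'.
  have [//||/=|c' yE] := nak' _ x' _ _ (map_mx pa y).
  - by rewrite xt' /row_full mxrank1.
  - by rewrite -rpi_lc Ky; apply/rpi_eq0; exact: rpred0.
  have [c cE] := map_pi_surj c'; exists (map_mx (residue m) c).
  have Kx i : lc g (x i) = 0 by case: (xE i).
  have Kxc : lc g (lc x c) = 0 by apply: submod_lc Ksub _.
  have z0 : rsubmx (tau (y - lc x c)) = 0.
    apply/Wp; exists (y - lc x c); split=> //; first by rewrite linearB /= Ky Kxc subr0.
    rewrite map_mxB yE map_pi_lc cE; apply/eqP; rewrite subr_eq0; apply/eqP.
    by congr lc; apply/funext => i; case: (xE i).
  have -> : w = rsubmx (tau (lc x c)).
    transitivity (rsubmx (tau y)); first by rewrite ty row_mxKr.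
    rewrite -[y](subrK (lc x c)) -[y - _]scale1r lin //.
      by rewrite rmorph1 scale1r linearD /= z0 add0r.
    by rewrite /= linearB /= Ky Kxc subr0.
  rewrite (res_coord_lc Ksub tr) // -mulmx_rsub; congr (_ *m _).
  by apply/matrixP => i j; rewrite !mxE.
(* Lifts of the first e basis vectors are taken in $a^n$ and vanish in K', so the other d1 already
   generate K'. *)
have /choice[x xE] : forall i : 'I_(e + d1), exists x, [/\ lc g x = 0,
    tau x = row i 1%:M & (i < e)%N -> map_mx pa x = 0].
  move=> i; case: (ltnP i e) => ie; last first.
    by have [x Kx tx] := surj (row i 1%:M); exists x.
  have [|x [Kx xa tx]] := (Wp (row i 1%:M)).1; last by exists x.
  apply/rowP => j; rewrite !mxE; case: eqP => // ij; move: ie.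
  by rewrite ij /= ltnNge leq_addr.
apply: (res_coord_leq Ksub' tr' (x := fun i => map_mx pa (x (rshift e i)))).
  move=> i /=; rewrite -rpi_lc; have [-> _ _] := xE (rshift e i).
  by apply/rpi_eq0; exact: rpred0.
move=> y' /(redmod_ker_lift gs)[y [Ky <-]].
have [||c ->] := nak _ x _ _ y Ky; first by move=> i; case: (xE i).
  rewrite (_ : \matrix_i _ = 1%:M) ?/row_full ?mxrank1 //.
  by apply/row_matrixP => i; rewrite rowK; case: (xE i).
exists (rsubmx (map_mx pa c)); congr tau'.
rewrite map_pi_lc /lc big_split_ord /= big1 ?add0r => [|i _].
  by apply: eq_bigr => i _; rewrite !mxE.
have [_ _ ->] := xE (lshift d1 i); first by rewrite scaler0.
by rewrite /= ltn_ord.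
Qed.

End Reduction.

Lemma finite_generators (R : comNzRingType) (V : lmodType R) :
  finite_set [set: V] -> exists r (x : 'I_r -> V), forall y, exists v, lc x v = y.
Proof.
move=> /finite_seqP[s sE]; exists (size s), (fun i => s`_i) => y.
have ys : y \in s by have : [set: V] y by []; rewrite sE.
have ix : (index y s < size s)%N by rewrite index_mem.
by exists (delta_mx 0 (Ordinal ix)); rewrite lc_delta nth_index.
Qed.

(** An automorphism is determined by its values on generators; this also yields the finiteness of
    [lmod_aut V]. *)
Lemma ncard_lmod_aut_generators (R : comNzRingType) (V : lmodType R) n (e : 'I_n -> V) :
  finite_set [set: V] -> (forall y, exists v, lc e v = y) ->
  let B := [set [ffun i => f (e i)] | f in lmod_aut V] in
  finite_set B /\ ncard B = ncard (lmod_aut V).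
Proof.
move=> Vfin es B.
have Bfin : finite_set B.
  have [fin _] := ncard_ffun 'I_n Vfin.
  by apply: sub_finite_set fin => v _ j.
have inj : {in lmod_aut V &, injective (fun f : V -> V => [ffun i => f (e i)])}.
  move=> f h /set_mem[lf _] /set_mem[lh _] /ffunP fh; apply/funext => y.
  have [v <-] := es y; rewrite !lc_comp_linear //; congr lc; apply/funext => i /=.
  by have := fh i; rewrite !ffunE.
split=> //; rewrite /B ncard_image //.
by rewrite -(eq_finite_set (inj_card_eq inj)).
Qed.

Lemma lmod_aut_idealmod (R : comNzRingType) (a : idealr R) (V : lmodType R) f x :
  lmod_aut V f -> (f x \in idealmod a V) <-> (x \in idealmod a V).
Proof.
move=> [lf [h fK hK]].
pose F : {linear V -> V} := HB.pack f (GRing.isLinear.Build R V V *:%R f lf).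
split=> /asboolP[l [c [y [ca xE]]]]; apply/asboolP.
  exists l, c, (h \o y); split=> //; apply: (can_inj fK); rewrite xE.
  rewrite [RHS](linear_sum F); apply: eq_bigr => j _.
  by rewrite [RHS](linearZ_LR F) /= hK.
exists l, c, (f \o y); split=> //; rewrite xE [LHS](linear_sum F).
by apply: eq_bigr => j _; rewrite [LHS](linearZ_LR F).
Qed.

(** * Surjections compatible with the reduction *)

Section Surjections.
Variables (R : comNzRingType) (m : maxIdealr R) (a : idealr R).
Hypothesis am : {subset a <= m}.
Local Notation A := {ideal_quot a}.
Local Notation pa := \pi_A.
Hypothesis jac : in_jacobson m.
Hypothesis fg : fg_submodules R.
Variable G : lmodType R.
Hypothesis G_finite : finite_set [set: G].
Local Notation aG := (idealmod a G).
Variables (n N : nat) (Xbar : 'M[A]_(n, N)).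

Definition in_span (v : 'rV[R]_n) : Prop := exists w : 'rV[A]_N, map_mx pa v = w *m Xbar^T.

(** The hypothesis on [Xbar] becomes one reference surjection onto G/aG, of which the compatible
    maps lift the twists by automorphisms. *)
Lemma modmod_generators : lmod_iso (restr (cok Xbar)) (modmod a G) ->
  exists e : 'I_n -> modmod a G, (forall y, exists v, lc e v = y) /\
    forall v, lc e v = 0 <-> in_span v.
Proof.
move=> [h [h' hK h'K]].
pose e i := h (qpi (colspan Xbar) (delta_mx i 0) : restr (cok Xbar)).
have eE v : lc e v = h (qpi (colspan Xbar) (map_mx pa v)^T : restr (cok Xbar)).
  rewrite /lc /e; under eq_bigr do rewrite -linearZ; rewrite -linear_sum; congr (h _).
  rewrite (matrix_sum_delta (map_mx pa v)^T) linear_sum.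
  apply: eq_bigr => i _; rewrite big_ord1 linearZ !mxE /=.
  by [].
have spanE (v : 'rV[A]_n) : v^T \in colspan Xbar <-> exists w, v = w *m Xbar^T.
  split=> [/asboolP[w vE]|[w ->]].
    by exists w^T; rewrite -trmx_mul -vE trmxK.
  by apply/asboolP; exists w^T; rewrite trmx_mul trmxK.
exists e; split=> [y|v].
  have [x xE] := qpi_surj (h' y : cok Xbar); have [v vE] := map_pi_surj x^T.
  by exists v; rewrite eE vE trmxK xE h'K.
rewrite eE /in_span -spanE -qpi_eq0; split=> [h0|->]; last exact: linear0.
by rewrite -[LHS]hK h0 -(linear0 h) hK.
Qed.

(** A condition on the composite $R^n \to G \to G/aG$ only, so that it can be counted after
    reduction. *)
Definition compatible (g : 'I_n -> G) : Prop := forall v, lc g v \in aG <-> in_span v.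

Variable e : 'I_n -> modmod a G.
Hypothesis e_surj : forall y, exists v, lc e v = y.
Hypothesis e_ker : forall v, lc e v = 0 <-> in_span v.

Lemma finite_modmod : finite_set [set: modmod a G].
Proof.
apply: sub_finite_set (finite_image (qpi aG) G_finite) => y _.
by have [x <-] := qpi_surj y; exists x.
Qed.

Lemma compatibleP (g : 'I_n -> G) :
  compatible g <-> exists2 f, lmod_aut (modmod a G) f & forall i, f (e i) = qpi aG (g i).
Proof.
have gE v : lc g v \in aG <-> lc (qpi aG \o g) v = 0.
  by rewrite -linear_lc -qpi_eq0.
split=> [gc|[f [lf [f' fK _]] fe] v].
  apply: ker_eq_aut => // [|v]; first exact: finite_modmod.
  by rewrite e_ker -gE; split=> /gc.
rewrite gE -e_ker (_ : qpi aG \o g = f \o e); last by apply/funext => i /=; rewrite fe.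
rewrite -lc_comp_linear //.
pose F : {linear modmod a G -> modmod a G} :=
  HB.pack f (GRing.isLinear.Build R (modmod a G) (modmod a G) *:%R f lf).
have f0 : f 0 = 0 := linear0 F.
by split=> [f1|->//]; rewrite -[LHS]fK f1 -f0 fK.
Qed.

(** The tuple generates G modulo aG, hence modulo mG, and Nakayama's lemma applies. *)
Lemma compatible_surj (g : 'I_n -> G) : compatible g -> forall y, exists v, lc g v = y.
Proof.
move=> /compatibleP[f [lf [f' fK f'K]] fe].
have [r [x xs]] := finite_generators G_finite.
have [[tau tr] _] := betti_kernel jac fg xs.
have [_ _ nak] := tr => y.
have [//||//|v ->] := nak _ g _ _ y; last by exists v.
apply: (res_coord_full _ tr) => // z _.
have [v vE] := e_surj (f' (qpi aG z)); exists v.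
have : z - lc g v \in aG.
  rewrite -qpi_eq0 linearB /= linear_lc.
  rewrite (_ : qpi aG \o g = f \o e); last by apply/funext => i /=; rewrite fe.
  by rewrite -lc_comp_linear // vE f'K subrr.
have [lin _ _] := tr.
move=> /(res_coord_idealmod am tr) z0.
by rewrite -[z](subrK (lc g v)) -[z - _]scale1r lin // z0 scaler0 add0r.
Qed.

Definition compat_set : set {ffun 'I_n -> G} := [set g | compatible g].

Lemma finite_ffun_G (S : set {ffun 'I_n -> G}) : finite_set S.
Proof.
by have [fin _] := ncard_ffun 'I_n G_finite; apply: sub_finite_set fin => v _ j.
Qed.

Lemma finite_idealmod : finite_set [set` aG].
Proof. exact: sub_finite_set G_finite. Qed.

(** Reduction modulo aG maps the compatible tuples onto the twists of [e] by Aut(G/aG), and its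
    fibers are cosets of $(aG)^n$. *)
Lemma ncard_compatible :
  ncard compat_set = (ncard (lmod_aut (modmod a G)) * ncard [set` aG] ^ n)%N.
Proof.
have [Bfin <-] := ncard_lmod_aut_generators finite_modmod e_surj.
pose F (g : {ffun 'I_n -> G}) := [ffun i => qpi aG (g i)].
apply: (ncard_fiber (f := F)) => //; first exact: finite_ffun_G.
  move=> g /compatibleP[f fa fe]; exists f => //.
  by apply/ffunP => i; rewrite !ffunE fe.
move=> _ [f fa <-].
have /choice[g0 g0E] : forall i, exists x, qpi aG x = f (e i).
  by move=> i; exact: qpi_surj.
have [Dfin] := ncard_ffun 'I_n finite_idealmod; rewrite card_ord => <-.
pose T (v : {ffun 'I_n -> G}) := [ffun i => g0 i + v i].
have T_inj : injective T.
  by move=> v w /ffunP vw; apply/ffunP => i; have := vw i; rewrite !ffunE => /addrI.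
rewrite -[RHS](ncard_image (f := T)) //; last by move=> v w _ _; exact: T_inj.
congr ncard; apply/seteqP; split=> [g [gc /= gE]|_ [v va <-]] /=.
  exists [ffun i => g i - g0 i]; last by apply/ffunP => i; rewrite !ffunE addrC subrK.
  move=> i /=; rewrite ffunE -qpi_eq0 linearB /= g0E.
  by have := congr1 (fun h : {ffun _} => h i) gE; rewrite !ffunE => ->; rewrite subrr.
have TE i : qpi aG (T v i) = f (e i).
  by rewrite ffunE linearD /= g0E (qpi_eq0 _ _).2 ?addr0 //; exact: va.
split; first by apply/compatibleP; exists f.
by apply/ffunP => i; rewrite ffunE [RHS]ffunE TE.
Qed.

Definition ker_lc (g : {ffun 'I_n -> G}) : set 'rV[R]_n := [set v | lc g v = 0].

(** Tuples with the same kernel differ by an automorphism of G, which is unique because they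
    generate G. *)
Lemma ncard_kernels :
  ncard compat_set = (ncard (ker_lc @` compat_set) * ncard (lmod_aut G))%N.
Proof.
apply: (ncard_fiber (f := ker_lc)); [exact: finite_ffun_G| | |].
- exact/finite_image/finite_ffun_G.
- by move=> g gc; exists g.
move=> _ [g0 g0c <-].
have [_ <-] := ncard_lmod_aut_generators G_finite (compatible_surj g0c).
congr ncard; apply/seteqP; split=> [g [gc /= gk]|_ [f fa <-]] /=.
  have [||f fa fE] := ker_eq_aut (e := g0) (g := g) G_finite.
  - exact: compatible_surj.
  - by move=> v; rewrite -[lc g v = 0]/(ker_lc g v) gk.
  by exists f => //; apply/ffunP => i; rewrite ffunE fE.
have fgE v : lc [ffun i => f (g0 i)] v = f (lc g0 v).
  rewrite lc_comp_linear; last by case: fa.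
  by congr lc; apply/funext => i; rewrite ffunE.
split; first by move=> v; rewrite fgE lmod_aut_idealmod //; exact: g0c.
have [lf [f' fK _]] := fa.
pose F : {linear G -> G} := HB.pack f (GRing.isLinear.Build R G G *:%R f lf).
have f0 : f 0 = 0 := linear0 F.
apply/seteqP; split=> v; rewrite /ker_lc /= fgE => v0; last by rewrite v0.
by rewrite -[LHS]fK v0 -f0 fK.
Qed.

End Surjections.

(** * The conditional probability *)

Section ConditionalProbability.
Variables (K : realType) (R : comNzRingType) (m : maxIdealr R) (a : idealr R).
Hypothesis am : {subset a <= m}.
Local Notation A := {ideal_quot a}.
Local Notation pa := \pi_A.
Local Notation k := (residue_field m).
Local Notation mpow := (ideal_pow [set` m]).
Hypothesis jac : in_jacobson m.
Hypothesis fg : fg_submodules R.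
Hypothesis Ra_finite : finite_set [set: A].
Hypothesis k_finite : finite_set [set: k].
Variable G : lmodType R.
Hypothesis G_finite : finite_set [set: G].
Local Notation aG := (idealmod a G).
Variables (n u : nat).
Local Notation N := (n + u)%N.
Variable mu : probability (borel_mx m n N) K.
Hypothesis haar : haar_probability mu.
Variable Xbar : 'M[A]_(n, N).
Local Notation b0 := (betti m G 0).
Local Notation b1 := (betti m G 1).
Local Notation b1' := (betti (quot_maxideal am) (redmod a G) 1).
Local Notation q := (ncard [set: k]).

(** At such a level, X modulo $m^L$ decides both its class modulo a and the images of its columns in
    G. *)
Lemma exists_level : exists L,
  (forall x (v : G), mpow L x -> x *: v = 0) /\ forall x, mpow L x -> x \in a.
Proof.
have [L1 L1E] := ideal_pow_annihilates jac G_finite.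
(* R/a is viewed as an R-module: whatever kills its unit lies in a. *)
have [L2 L2E] := @ideal_pow_annihilates _ _ (restr (A^o : lmodType A)) jac Ra_finite.
exists (maxn L1 L2); split=> [x v|x] /ideal_pow_le xL.
  by apply: L1E; apply: xL; exact: leq_maxl.
apply/pi_ideal_eq0; have := L2E x (1 : A^o) (xL _ (leq_maxr _ _)).
by move=> <-; rewrite -[RHS]/(pa x * 1) mulr1.
Qed.

Variable L : nat.
Hypothesis mpowG : forall x (v : G), mpow L x -> x *: v = 0.
Hypothesis mpowa : forall x, mpow L x -> x \in a.

Definition coset : set 'M[R]_(n, N) := [set X | map_mx pa X = Xbar].

Lemma cosetD X Y : coset X -> map_mx pa Y = 0 -> coset (X + Y).
Proof. by rewrite /coset /= map_mxD => -> ->; rewrite addr0. Qed.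

Lemma map_pi_mpow p r (Y : 'M[R]_(p, r)) :
  (forall i j, mpow L (Y i j)) -> map_mx pa Y = 0.
Proof. by move=> YL; apply/map_pi_eq0 => i j; exact: mpowa. Qed.

Lemma row_trD p r (X Y : 'M[R]_(p, r)) j : row j (X + Y)^T = row j X^T + row j Y^T.
Proof. by apply/rowP => i; rewrite !mxE. Qed.

(** The classes modulo a are finitely many translates of one another with total mass 1; the
    conditional probability thus has a nonzero denominator. *)
Lemma pr_coset_gt0 : 0 < pr mu coset.
Proof.
have [Bfin _] := ncard_mx n N Ra_finite.
pose f (X : 'M[R]_(n, N)) := map_mx pa X.
have clo B : clopen_mx m ([set: 'M[R]_(n, N)] `&` f @^-1` [set B]).
  exists L => X Y [_ /= XB] YL; split=> //=.
  by rewrite /f map_mxD (map_pi_mpow YL) addr0.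
have := pr_fibers (mu := mu) (f := f) (C := setT) (S := setT) (c := pr mu coset) Bfin
  (fun B _ => clo B).
have -> : [set: 'M[R]_(n, N)] `&` f @^-1` setT = setT by apply/seteqP; split.
have -> : pr mu setT = 1.
  by rewrite /pr; have -> := congr1 fine (probability_setT mu).
move=> H.
rewrite lt0r; apply/andP; split; last by rewrite /pr fine_ge0.
apply/eqP => c0.
suff : (1 : K) = 0 by move/eqP; rewrite oner_eq0.
rewrite H ?c0 ?mulr0 // => B _; rewrite -[RHS]c0.
have [Y YE] := map_pi_surj (Xbar - B).
apply: (pr_translate haar (Y := Y)) => //.
  by move=> X [_ /= XB]; rewrite /coset /= map_mxD YE -XB subrK.
by move=> X /= XB; split=> //=; rewrite /f map_mxB XB YE opprB addrC subrK.
Qed.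

Definition kernel_coset (g : 'I_n -> G) : set 'M[R]_(n, N) :=
  [set X | coset X /\ forall j, lc g (row j X^T) = 0].

Definition span_set (g : 'I_n -> G) : set 'M[R]_(n, N) :=
  [set X | coset X /\ forall v, lc g v = 0 <-> exists w, v = w *m X^T].

Lemma coset_in_span X j : coset X -> in_span Xbar (row j X^T).
Proof.
move=> XC; exists (delta_mx 0 j).
by rewrite -rowE map_row -map_trmx XC.
Qed.

(** Provides translations that preserve the class modulo a and move the images of the columns by any
    tuple of aG. *)
Lemma shift_rows (g : 'I_n -> G) (t : 'I_N -> G) :
  (forall y, exists v, lc g v = y) -> (forall j, t j \in aG) ->
  exists Y : 'M[R]_(n, N), map_mx pa Y = 0 /\ forall j, lc g (row j Y^T) = t j.
Proof.
move=> gs ta; have /choice[y yE] : forall j, exists y, map_mx pa y = 0 /\ lc g y = t j.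
  by move=> j; have [y y0 yt] := idealmod_lcP gs (ta j); exists y.
exists (\matrix_j y j)^T; split=> [|j]; last by rewrite trmxK rowK; case: (yE j).
apply/trmx_inj; rewrite map_trmx trmxK trmx0; apply/row_matrixP => j.
by rewrite -map_row rowK row0; case: (yE j).
Qed.

Section Compatible.
Variable g : 'I_n -> G.
Hypothesis gc : compatible Xbar g.
Hypothesis gs : forall y, exists v, lc g v = y.

Lemma kernel_coset_inhabited : exists X, kernel_coset g X.
Proof.
have [X XE] := map_pi_surj Xbar.
have [|Y [Y0 YE]] := shift_rows (t := fun j => - lc g (row j X^T)) gs.
  by move=> j; rewrite rpredN; apply/gc/coset_in_span.
exists (X + Y); split=> [|j]; first exact: cosetD.
by rewrite row_trD linearD /= YE subrr.
Qed.

(** On the coset, g sends the columns into aG, and all $|aG|^N$ tuples of values are equally likely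
    by translation; [kernel_coset g] is the fiber over 0. *)
Lemma pr_kernel_coset :
  pr mu coset = (ncard [set` aG] ^ N)%N%:R * pr mu (kernel_coset g).
Proof.
pose f (X : 'M[R]_(n, N)) := [ffun j => lc g (row j X^T)].
have [Sfin] := ncard_ffun 'I_N (finite_idealmod a G_finite).
rewrite card_ord => <-; set S := [set v | _] in Sfin *.
have CS : coset = coset `&` f @^-1` S.
  apply/seteqP; split=> [X XC|X []//]; split=> // j.
  by rewrite ffunE; apply/gc/coset_in_span.
rewrite {1}CS; apply: pr_fibers => // t tS.
  exists L => X Y [XC /= Xt] YL; split; first by apply: cosetD => //; exact: map_pi_mpow.
  rewrite /= -Xt; apply/ffunP => j; rewrite !ffunE row_trD linearD /=.
  rewrite [X in _ + X]big1 ?addr0 // => i _; rewrite !mxE.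
  exact: mpowG.
have [Y [Y0 YE]] := shift_rows gs tS.
apply/esym; apply: (pr_translate haar (Y := Y)).
- exists L => X Z [XC Xk] ZL; split; first by apply: cosetD => //; exact: map_pi_mpow.
  move=> j; rewrite row_trD linearD /= Xk add0r /lc big1 // => i _; rewrite !mxE.
  exact: mpowG.
- move=> X [XC Xk]; split; first by rewrite addrC; exact: cosetD.
  by apply/ffunP => j; rewrite ffunE row_trD linearD /= Xk addr0 YE.
move=> X [XC /= Xt]; split.
  by apply: cosetD => //; rewrite map_mxN Y0 oppr0.
move=> j; have := congr1 (fun h : {ffun _} => h j) Xt; rewrite ffunE => Xtj.
by rewrite row_trD linearN /= linearD /= Xtj linearN linearN /= YE subrr.
Qed.

(** $m^L R^n$ lies in K, so one more factor of m is what puts $m^{L+1} R^n$ in mK; hence the level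
    [L.+1]. *)
Lemma mpow_res_coord d (tau : 'rV[R]_n -> 'rV[k]_d) (x : 'rV[R]_n) :
  res_coord [set v | lc g v = 0] tau -> (forall i, mpow L.+1 (x 0 i)) ->
  lc g x = 0 /\ tau x = 0.
Proof.
move=> tr xL; have Ksub := ker_submod (lc g).
have Zsub := submod_res_coord0 Ksub tr.
rewrite (row_sum_delta x); apply: (submod_sum Zsub) => i.
have [l [y [z [ym zL ->]]]] := xL i; rewrite scaler_suml.
apply: (submod_sum Zsub) => j; rewrite -scalerA.
apply: (res_coord_ideal Ksub tr); first exact: ym.
by rewrite /= linearZ /= lc_delta; apply: mpowG; exact: zL.
Qed.

Lemma pr_span_set : clopen_mx m (span_set g) /\
  pr mu (span_set g) = pr mu coset / (ncard [set` aG] ^ N)%N%:R *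
    if (b1 <= b0 + u)%N then
      \prod_((u + b0 - b1).+1 <= i < (u + b0 - b1').+1) (1 - q%:R ^- i) else 0.
Proof.
have [e [d1 [tau [tr E1 E2 Wp]]]] :=
  adapted_coordinates am jac fg Ra_finite k_finite gs.
have Ksub := ker_submod (lc g); have [lin surj nak] := tr.
have tauD x y : lc g x = 0 -> lc g y = 0 -> tau (x + y) = tau x + tau y.
  by move=> xK yK; rewrite -[x]scale1r lin // rmorph1 !scale1r.
have tauB x y : lc g x = 0 -> lc g y = 0 -> tau (x - y) = tau x - tau y.
  by move=> xK yK; rewrite -scaleN1r addrC lin // rmorphN1 scaleN1r addrC.
pose T (X : 'M[R]_(n, N)) := \matrix_j tau (row j X^T).
pose F (X : 'M[R]_(n, N)) := lsubmx (T X).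
have [X1 X1k] := kernel_coset_inhabited.
pose B1 := rsubmx (T X1).
(* Two matrices of [kernel_coset g] differ by columns in $K \cap a^n$, so the last d1 coordinates do
   not depend on X. *)
have TB X : kernel_coset g X -> T X = row_mx (F X) B1.
  move=> Xk; rewrite -[LHS]hsubmxK; congr row_mx; apply/eqP.
  rewrite -subr_eq0 -linearB; apply/eqP/row_matrixP => j; rewrite row0.
  have -> : row j (rsubmx (T X - T X1)) = rsubmx (tau (row j (X - X1)^T)).
    rewrite row_trD (_ : row j (- X1)^T = - row j X1^T); last by apply/rowP => i; rewrite !mxE.
    rewrite tauB; [|by case: Xk|by case: X1k].
    by apply/rowP => i; rewrite !mxE.
  apply/Wp; exists (row j (X - X1)^T); split=> //.
    rewrite row_trD (_ : row j (- X1)^T = - row j X1^T); last by apply/rowP => i; rewrite !mxE.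
    by rewrite linearB /= Xk.2 X1k.2 subrr.
  by rewrite map_row -map_trmx map_mxB Xk.1 X1k.1 subrr trmx0 row0.
have rowK' X : kernel_coset g X -> forall j, lc g (row j X^T) = 0 by case.
(* Compatibility puts every vector of K, modulo a, in the span of [Xbar]; hence the columns of [X1]
   span V / W. *)
have rB1 : \rank B1 = d1.
  suff : row_full B1 by move/eqP.
  apply: row_full_surj => b.
  have [x xK tx] := surj (row_mx 0 b).
  have [w' xw] : in_span Xbar x by apply/gc; rewrite xK; exact: rpred0.
  have [w wE] := map_pi_surj w'; exists (map_mx (residue m) w).
  have X1w : lc g (w *m X1^T) = 0.
    by rewrite mulmx_lc; apply: submod_lc Ksub _ => j; exact: rowK'.
  have z0 : rsubmx (tau (x - w *m X1^T)) = 0.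
    apply/Wp; exists (x - w *m X1^T); split=> //; first by rewrite linearB /= xK X1w subrr.
    by rewrite map_mxB map_mxM wE xw -map_trmx X1k.1 subrr.
  move: z0; rewrite tauB // linearB /= tx row_mxKr => /eqP; rewrite subr_eq0 => /eqP ->.
  rewrite mulmx_lc (res_coord_lc Ksub tr); last by move=> j; exact: rowK'.
  by rewrite -mulmx_rsub; congr (_ *m rsubmx _); apply/row_matrixP => j; rewrite !rowK.
pose S' : set 'M[k]_(N, e) := [set B | row_full (row_mx B B1)].
have spanE : span_set g = kernel_coset g `&` F @^-1` S'.
  apply/seteqP; split=> X.
    move=> [XC Xs]; have Xk : kernel_coset g X.
      by split=> // j; apply/Xs; exists (delta_mx 0 j); rewrite -rowE.
    split=> //; rewrite /S' /= -TB //.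
    apply: (res_coord_full Ksub tr) => [j|y /Xs[w ->]]; first exact: rowK'.
    by exists w; rewrite mulmx_lc.
  move=> [Xk]; rewrite /S' /= -TB // => full; split=> [|v]; first by case: Xk.
  split=> [vK|[w ->]].
    have [c ->] := nak _ _ (rowK' X Xk) full v vK.
    by exists c; rewrite mulmx_lc.
  by rewrite mulmx_lc; apply: submod_lc Ksub _ => j; exact: rowK'.
have inv (X Y : 'M[R]_(n, N)) : kernel_coset g X -> (forall i j, mpow L.+1 (Y i j)) ->
    kernel_coset g (X + Y) /\ F (X + Y) = F X.
  move=> Xk YL.
  have rY j : lc g (row j Y^T) = 0 /\ tau (row j Y^T) = 0.
    by apply: mpow_res_coord => // i; rewrite !mxE.
  split.
    split=> [|j]; last by rewrite row_trD linearD /= (rY j).1 Xk.2 addr0.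
    by apply: cosetD; [case: Xk|apply: map_pi_mpow => i j; exact/ideal_powS/YL].
  congr lsubmx; apply/row_matrixP => j.
  by rewrite !rowK row_trD tauD ?(rY j).2 ?addr0 ?(rY j).1 ?Xk.2.
have clo S : clopen_mx m (kernel_coset g `&` F @^-1` S).
  exists L.+1 => X Y [Xk /= XS] YL; have [XYk FE] := inv X Y Xk YL.
  by split=> //=; rewrite FE.
split; first by rewrite spanE.
pose c := pr mu (kernel_coset g `&` F @^-1` [set 0]).
(* Any B is the change in [F] under translation by a matrix with columns in $K \cap a^n$, so [F] is
   uniform on [kernel_coset g]. *)
have fib (B : 'M[k]_(N, e)) : pr mu (kernel_coset g `&` F @^-1` [set B]) = c.
  have /choice[y yE] : forall j : 'I_N, exists y : 'rV[R]_n,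
      [/\ lc g y = 0, map_mx pa y = 0 & tau y = row_mx (row j B) 0].
    by move=> j; apply/Wp; rewrite row_mxKr.
  pose Y := (\matrix_j y j)^T.
  have rY j : row j Y^T = y j by rewrite trmxK rowK.
  have Y0 : map_mx pa Y = 0.
    apply/trmx_inj; rewrite map_trmx trmxK trmx0; apply/row_matrixP => j.
    by rewrite -map_row rowK row0; case: (yE j).
  have FY X : kernel_coset g X -> F (Y + X) = B + F X.
    move=> Xk; apply/row_matrixP => j; rewrite linearD /=.
    have rF Z : row j (F Z) = lsubmx (tau (row j Z^T)).
      by apply/rowP => i; rewrite !mxE.
    rewrite !rF row_trD tauD ?rY; [|by case: (yE j)|by case: Xk].
    by case: (yE j) => _ _ ->; rewrite linearD /= row_mxKl.
  have kY X : kernel_coset g X -> kernel_coset g (Y + X).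
    move=> [XC Xk]; split=> [|j]; first by rewrite addrC; exact: cosetD.
    by rewrite row_trD linearD /= Xk rY addr0; case: (yE j).
  have kNY X : kernel_coset g X -> kernel_coset g (X - Y).
    move=> [XC Xk]; split=> [|j]; first by apply: cosetD; rewrite // map_mxN Y0 oppr0.
    rewrite row_trD linearD /= Xk add0r linearN linearN linearN /= rY.
    by case: (yE j) => -> _ _; rewrite oppr0.
  apply/esym; apply: (pr_translate haar (Y := Y)) => // X [Xk /= XF].
    by split; [exact: kY|rewrite /= FY // XF addr0].
  split; first exact: kNY.
  have := FY _ (kNY _ Xk); rewrite addrC subrK XF => /eqP.
  by rewrite addrC -subr_eq subrr eq_sym => /eqP.
have [Bfin cB] := ncard_mx N e k_finite.
have -> : pr mu (span_set g) = (ncard S')%:R * c.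
  by rewrite spanE; apply: pr_fibers => //; exact: sub_finite_set Bfin.
have q0 : (0 < q)%N by apply: (ncard_gt0 (x := 0)).
have -> : pr mu coset = (ncard [set` aG] ^ N)%N%:R * ((q ^ (N * e))%N%:R * c).
  rewrite pr_kernel_coset; congr (_ * _); rewrite -cB.
  rewrite -[kernel_coset g in LHS]setIT -(preimage_setT F).
  by apply: pr_fibers => // t _; exact: clo.
have aG0 : (ncard [set` aG] ^ N)%N%:R != 0 :> K.
  rewrite pnatr_eq0 -lt0n expn_gt0 (ncard_gt0 (x := 0)) //; first exact: finite_idealmod.
  exact: rpred0.
have qN0 : (q ^ (N * e))%N%:R != 0 :> K by rewrite pnatr_eq0 -lt0n expn_gt0 q0.
rewrite [_ / _]mulrAC divff // mul1r /S' (ncard_full_extension _ k_finite rB1).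
(* This bound keeps the subtraction in [u + b0 - b1'] from truncating. *)
have d1N : (d1 <= N)%N by rewrite -rB1 rank_leq_row.
case: ifP => b1u.
  have leN : (d1 + e <= N)%N by lia.
  have -> : (u + b0 - b1)%N = (N - (d1 + e))%N by lia.
  have -> : (u + b0 - b1')%N = (N - d1)%N by lia.
  rewrite -prod_extension_ratio //.
  by rewrite mulrC -[RHS]mulrA mulrCA mulrA; field.
rewrite mulr0 prod_extension_eq0 ?mul0r //.
lia.
Qed.

End Compatible.

End ConditionalProbability.

(* The value [p] is fixed before [n], [mu] and [Xbar]: it depends on none of
   them. *)
Theorem theorem3p3 (K : realType)
    (R : comNzRingType) (m : maxIdealr R)
    (R_noetherian : noetherian R)
    (R_local : local_ring m)
    (R_complete : adically_complete m)
    (residue_finite : finite_set [set: residue_field m])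
    (a : idealr R) (a_sub_m : {subset a <= m})
    (Ra_finite : finite_set [set: {ideal_quot a}])
    (G : lmodType R) (G_finite : finite_set [set: G])
    (u : nat) :
  let q : K := (ncard [set: residue_field m])%:R in
  let b0 := betti m G 0 in
  let b1 := betti m G 1 in
  let b1' := betti (quot_maxideal a_sub_m) (redmod a G) 1 in
  let p : K :=
    if (b1 <= b0 + u)%N then
      (ncard (lmod_aut (modmod a G)))%:R
        / ((ncard (lmod_aut G))%:R * (ncard [set` idealmod a G])%:R ^+ u)
      * \prod_((u + b0 - b1).+1 <= i < (u + b0 - b1').+1) (1 - q ^- i)
    else 0 in
  forall (n : nat) (n_gt0 : (0 < n)%N)
    (mu : probability (borel_mx m n (n + u)) K) (mu_haar : haar_probability mu)
    (Xbar : 'M[{ideal_quot a}]_(n, n + u))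
    (Xbar_cok : lmod_iso (restr (cok Xbar)) (modmod a G)),
  cond_prob mu
    [set X : 'M[R]_(n, n + u) | lmod_iso (cok X) G]
    [set X : 'M[R]_(n, n + u) | map_mx \pi_{ideal_quot a} X = Xbar]
  = p.
Proof.
move=> q b0 b1 b1' p n n_gt0 mu haar Xbar Xiso.
have jac := complete_in_jacobson R_complete.
have fg := fg_submodules_noetherian R_noetherian.
have [e [es ek]] := modmod_generators Xiso.
have [L [LG La]] := exists_level jac Ra_finite G_finite.
pose C := coset Xbar.
have C0 : pr mu C != 0 by rewrite gt_eqF // (pr_coset_gt0 Ra_finite haar _ La).
(* The event is split by the column span of X, not by g: maps g in one Aut(G)-orbit give the same
   matrices. *)
pose f (X : 'M[R]_(n, n + u)) : set 'rV[R]_n := [set v | exists w, v = w *m X^T].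
pose S := @ker_lc R G n @` (compat_set (G := G) Xbar).
have gsurj g : compatible Xbar g -> forall y : G, exists v, lc g v = y.
  exact: (compatible_surj a_sub_m jac fg G_finite es ek).
have EC : [set X : 'M[R]_(n, n + u) | lmod_iso (cok X) G] `&` C = C `&` f @^-1` S.
  apply/seteqP; split=> X [] /=.
    move=> /cok_iso_generators[g [gs gk]] XC; split=> //.
    exists [ffun i => g i]; last first.
      apply/seteqP; split=> v; rewrite /ker_lc /f /=;
        by rewrite (_ : lc [ffun i => g i] v = lc g v) ?gk //;
           congr lc; apply/funext => i; rewrite ffunE.
    move=> v; rewrite (_ : lc [ffun i => g i] v = lc g v); last first.
      by congr lc; apply/funext => i; rewrite ffunE.
    split=> [/(idealmod_lcP gs)[v' v'0 v'E]|[w' vw']].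
      have [w vw] : exists w, v - v' = w *m X^T.
        by apply/gk; rewrite linearB /= v'E subrr.
      exists (map_mx \pi_{ideal_quot a} w).
      by rewrite -XC map_trmx -map_mxM -vw map_mxB v'0 subr0.
    have [w wE] := map_pi_surj w'.
    have -> : lc g v = lc g (v - w *m X^T).
      by rewrite linearB /= [X in _ - X](_ : _ = 0) ?subr0 //; apply/gk; exists w.
    apply: idealmod_lc; rewrite map_mxB map_mxM wE vw' -map_trmx XC.
    by rewrite subrr.
  move=> XC [g gc gf]; split=> //; apply/cok_iso_generators.
  exists g; split; first exact: gsurj.
  by move=> v; rewrite -[lc g v = 0]/(ker_lc g v) gf.
have spanE g : C `&` f @^-1` [set ker_lc g] = span_set Xbar g.
  apply/seteqP; split=> X [XC] /=.
    by move=> fX; split=> // v; rewrite -[lc g v = 0]/(ker_lc g v) -fX.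
  by move=> Xs; split=> //; apply/seteqP; split=> v /Xs.
have span g (gc : compatible Xbar g) :=
  pr_span_set a_sub_m jac fg Ra_finite residue_finite G_finite haar LG La gc (gsurj g gc).
have Sfin : finite_set S by exact/finite_image/finite_ffun_G.
have cK := ncard_kernels a_sub_m jac fg G_finite es ek.
rewrite (ncard_compatible G_finite es ek) -/S in cK.
have aut0 : (0 < ncard (lmod_aut G))%N.
  have [r [x xs]] := finite_generators G_finite.
  have [Bfin <-] := ncard_lmod_aut_generators G_finite xs.
  apply: (ncard_gt0 (x := [ffun i => x i])) => //; exists id => //.
  by split=> //; exists id.
have aG0 : (0 < ncard [set` idealmod a G])%N.
  by apply: (ncard_gt0 (x := 0)); [exact: finite_idealmod|exact: rpred0].
set ratio := if _ then _ else _ in span.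
rewrite /cond_prob EC -[fine (mu (C `&` _))]/(pr mu (C `&` f @^-1` S)) -[fine _]/(pr mu C).
have -> : pr mu (C `&` f @^-1` S) = (ncard S)%:R *
    (pr mu C / (ncard [set` idealmod a G] ^ (n + u))%N%:R * ratio).
  apply: pr_fibers => // _ [g gc <-]; rewrite spanE.
    by case: (span g gc).
  by case: (span g gc).
(* The power $|aG|^n$ in the number of kernels meets $|aG|^{-(n+u)}$ from each of them. *)
have {cK} cK : (ncard S)%:R = (ncard (lmod_aut (modmod a G)))%:R *
    (ncard [set` idealmod a G])%:R ^+ n / (ncard (lmod_aut G))%:R :> K.
  apply/eqP; rewrite eq_sym; apply/eqP/(canLR (mulfK _)); first by rewrite pnatr_eq0 -lt0n.
  by rewrite -natrX -!natrM cK.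
have h1 : (ncard (lmod_aut G))%:R != 0 :> K by rewrite pnatr_eq0 -lt0n.
have h2 : (ncard [set` idealmod a G])%:R != 0 :> K by rewrite pnatr_eq0 -lt0n.
rewrite cK natrX exprD.
have -> : p = (ncard (lmod_aut (modmod a G)))%:R
        / ((ncard (lmod_aut G))%:R * (ncard [set` idealmod a G])%:R ^+ u) * ratio.
  by rewrite /p /ratio; case: ifP => // _; rewrite mulr0.
by field; rewrite C0 h1 !expf_neq0.
Qed.
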